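(* Suppose $n$ is an even integer with $t_2+t_3\leq n<t_1$, and put $K=k_1+k_2+k_3$, $N=\tfrac{n+1}{2}$. Then: (i) the $\mathfrak{BI}$-module $\mathscr M_n(x_2)\cap\mathscr M_n(x_3)$ is isomorphic to $W_1\oplus W_1$, where $W_1=O_{n-t_2-t_3}(k_1+k_3+N,\,-k_1-k_2-N,\,-N)^{((-1,1),(1\,3))}$; (ii) the $\mathfrak{BI}$-modules $\mathscr M_n(x_3)/(\mathscr M_n(x_2)\cap\mathscr M_n(x_3))$ and $\mathscr M_n/\mathscr M_n(x_2)$ are each isomorphic to $W_2\oplus W_2$, where $W_2=O_{t_2-1}(k_1,\,-K-n-1,\,-k_3)^{((1,-1),(1\,3))}$; (iii) the $\mathfrak{BI}$-modules $\mathscr M_n(x_2)/(\mathscr M_n(x_2)\cap\mathscr M_n(x_3))$ and $\mathscr M_n/\mathscr M_n(x_3)$ are each isomorphic to $W_3\oplus W_3$, where $W_3=O_{t_3-1}(k_1,\,-K-n-1,\,-k_2)^{((1,-1),(1\,3\,2))}$. Moreover, if $k_1\geq0$, then $W_1,W_2,W_3$ are irreducible and are isomorphic to $O_{n-t_2-t_3}(N,\,-k_1-k_2-N,\,-k_1-k_3-N)$, $O_{t_2-1}(k_3,\,K+n+1,\,k_1)$ and $O_{t_3-1}(k_2,\,k_1,\,K+n+1)$, respectively.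
   Context: Fix real numbers $k_1,k_2,k_3$. For $i=1,2,3$ let $R_i$ be the operator on functions on $\mathbb R^3$ replacing $x_i$ by $-x_i$, and $T_if=\frac{\partial f}{\partial x_i}+k_i\frac{f-R_if}{x_i}$ (Dunkl operators). Let $\sigma_1=\begin{pmatrix}0&1\\1&0\end{pmatrix}$, $\sigma_2=\begin{pmatrix}0&-\sqrt{-1}\\ \sqrt{-1}&0\end{pmatrix}$, $\sigma_3=\begin{pmatrix}1&0\\0&-1\end{pmatrix}$, and let $e_i$ act on $\mathbb C^2$ by $\sigma_i$. Tensor products are over $\mathbb R$; $\mathbb R[\cdots]_m$ denotes homogeneous polynomials of degree $m$. Let $\mathbf D=e_1\otimes T_1+e_2\otimes T_2+e_3\otimes T_3$ and $\mathscr M_n=\ker(\mathbf D|_{\mathbb C^2\otimes\mathbb R[x_1,x_2,x_3]_n})$. For $i=1,2,3$ set $t_i=-2k_i$ if $2k_i$ is an odd negative integer, and $t_i=\infty$ otherwise. For $i=1,2,3$, $\mathscr M_n(x_i)=\mathscr M_n\cap\bigoplus_{j=t_i}^n\mathbb C^2\otimes(x_i^j\cdot\mathbb R[x_p,x_q]_{n-j})$ where $\{p,q\}=\{1,2,3\}\setminus\{i\}$ (it is $\{0\}$ if $n<t_i$); it is a $\mathfrak{BI}$-submodule of $\mathscr M_n$. $\mathfrak{BI}$ is the unital associative $\mathbb C$-algebra generated by $X,Y,Z$ with relations saying that $\{X,Y\}-Z$, $\{Y,Z\}-X$, $\{Z,X\}-Y$ commute with $X,Y,Z$ ($\{A,B\}=AB+BA$).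 $\mathscr M_n$ is a $\mathfrak{BI}$-module via $X=(\sqrt{-1}\,e_1\otimes(x_3T_2-x_2T_3)+\tfrac12)R_2R_3+k_2R_3+k_3R_2$, $Y=(\sqrt{-1}\,e_2\otimes(x_1T_3-x_3T_1)+\tfrac12)R_1R_3+k_3R_1+k_1R_3$, $Z=(\sqrt{-1}\,e_3\otimes(x_2T_1-x_1T_2)+\tfrac12)R_1R_2+k_1R_2+k_2R_1$, operators composed right to left, $R_i$ acting on the polynomial factor. Twisting: for a $\mathfrak{BI}$-module $V$ and algebra automorphism $\varepsilon$, $V^\varepsilon$ is $V$ with action $x\cdot v=\varepsilon(x)v$. A permutation $\sigma\in\mathfrak S_3$ denotes the automorphism sending the generator with index $i$ in $(X,Y,Z)$ to the generator with index $\sigma(i)$; the sign automorphisms are $(1,-1)\colon X\mapsto X,Y\mapsto -Y,Z\mapsto -Z$; $(-1,1)\colon X\mapsto -X,Y\mapsto Y,Z\mapsto -Z$; $(-1,-1)\colon X\mapsto -X,Y\mapsto -Y,Z\mapsto Z$; a pair $(\epsilon,\sigma)$ denotes the composite $\epsilon\circ\sigma$. For $a,b,c\in\mathbb C$ and even $d\geq0$, $O_d(a,b,c)$ is the $\mathfrak{BI}$-module $\mathbb C^{d+1}$ in which, w.r.t. a basis $v_0,\dots,v_d$, $X$ acts by the lower bidiagonal matrix with diagonal $(\theta_0,\dots,\theta_d)$ and subdiagonal entries $1$, $Y$ by the upper bidiagonal matrix with diagonal $(\theta^*_0,\dots,\theta^*_d)$ and superdiagonal $(\varphi_1,\dots,\varphi_d)$,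 and $Z=\{X,Y\}-(2ab-c(d+1))$, where $\theta_i=\frac{(-1)^i(2a-d+2i)}{2}$, $\theta^*_i=\frac{(-1)^i(2b-d+2i)}{2}$, $\varphi_i=\frac{i(d+1-2i-2a-2b-2c)}{2}$ ($i$ even), $\varphi_i=\frac{(i-d-1)(d+1-2i-2a-2b+2c)}{2}$ ($i$ odd). *)

(* Defs.v *)
From HB Require Import structures.
From mathcomp Require Import all_boot all_order all_algebra all_fingroup.
From mathcomp Require Import reals.
From mathcomp Require Import complex.
From mathcomp Require Import mpoly.

Set Implicit Arguments.
Unset Strict Implicit.
Unset Printing Implicit Defensive.

Import Order.TTheory GRing.Theory Num.Theory.
Local Open Scope ring_scope.

(* [tparam k t] : "t_i = t" for the parameter k = k_i, i.e. 2k is the odd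
   negative integer -t.  If no such t exists, t_i = infinity. *)
Definition tparam (R : realType) (k : R) (t : nat) : Prop :=
  odd t /\ 2 * k = - (t%:R).

Definition kvec (R : realType) (k1 k2 k3 : R) (i : 'I_3) : R :=
  nth 0 [:: k1; k2; k3] i.

Section PolyModule.
Variable R : realType.
Local Notation C := (R[i]).
Local Notation Pol := {mpoly C[3]}.

(* C^2 (x)_R R[x1,x2,x3] is identified with C[x1,x2,x3]^2 = Pol * Pol,
   i.e. pairs (p,q) = e_+ (x) p + e_- (x) q in the standard basis of C^2. *)
Definition Cpt := (Pol * Pol)%type.

Definition rC (x : R) : C := (x%:C)%C.

Definition pmap (f : Pol -> Pol) (v : Cpt) : Cpt := (f v.1, f v.2).

Definition reflp (i : 'I_3) (p : Pol) : Pol :=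
  p \mPo [tuple (if j == i then - 'X_j else 'X_j) | j < 3].

(* exact division by x_i (on polynomials divisible by x_i):
   the monomial x^m is sent to x^(m - e_i) *)
Definition divX (i : 'I_3) (p : Pol) : Pol :=
  \sum_(m <- msupp p) p@_m *: 'X_[mnm_sub m (mnm1 i)].

Definition dunkl (k : 'I_3 -> R) (i : 'I_3) (p : Pol) : Pol :=
  p^`M(i) + rC (k i) *: divX i (p - reflp i p).

(* e_1, e_2, e_3 acting on C^2 by the Pauli matrices *)
Definition e1 (v : Cpt) : Cpt := (v.2, v.1).
Definition e2 (v : Cpt) : Cpt := (- ('i%C *: v.2), 'i%C *: v.1).
Definition e3 (v : Cpt) : Cpt := (v.1, - v.2).

Definition Dirac (k : 'I_3 -> R) (v : Cpt) : Cpt :=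
  e1 (pmap (dunkl k 0) v) + e2 (pmap (dunkl k 1) v) + e3 (pmap (dunkl k 2) v).

Definition homv (n : nat) (v : Cpt) : bool :=
  (v.1 \is n.-homog) && (v.2 \is n.-homog).

Definition Mn (k : 'I_3 -> R) (n : nat) : pred Cpt :=
  [pred v | homv n v && (Dirac k v == 0)].

Definition Mx (k : 'I_3 -> R) (i : 'I_3) (t n : nat) : pred Cpt :=
  [pred v | (v \in Mn k n)
            && all (fun m : 'X_{1..3} => (t <= m i)%N) (msupp v.1)
            && all (fun m : 'X_{1..3} => (t <= m i)%N) (msupp v.2)].

Definition ang (k : 'I_3 -> R) (a b : 'I_3) (p : Pol) : Pol :=
  'X_a * dunkl k b p - 'X_b * dunkl k a p.

Definition biX (k : 'I_3 -> R) (v : Cpt) : Cpt :=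
  let w := pmap (reflp 1) (pmap (reflp 2) v) in
  'i%C *: e1 (pmap (ang k 2 1) w) + 2^-1 *: w
  + rC (k 1) *: pmap (reflp 2) v + rC (k 2) *: pmap (reflp 1) v.

Definition biY (k : 'I_3 -> R) (v : Cpt) : Cpt :=
  let w := pmap (reflp 0) (pmap (reflp 2) v) in
  'i%C *: e2 (pmap (ang k 0 2) w) + 2^-1 *: w
  + rC (k 2) *: pmap (reflp 0) v + rC (k 0) *: pmap (reflp 2) v.

Definition biZ (k : 'I_3 -> R) (v : Cpt) : Cpt :=
  let w := pmap (reflp 0) (pmap (reflp 1) v) in
  'i%C *: e3 (pmap (ang k 1 0) w) + 2^-1 *: w
  + rC (k 0) *: pmap (reflp 1) v + rC (k 1) *: pmap (reflp 0) v.

Definition biop (k : 'I_3 -> R) (j : 'I_3) : Cpt -> Cpt :=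
  match val j with 0 => biX k | 1 => biY k | _ => biZ k end.

End PolyModule.

Section MatrixModules.
Variable F : fieldType.

(* a BI-module structure on F^m (column vectors): the matrices by which
   X, Y, Z (= generators 0, 1, 2) act *)
Definition bimx (m : nat) := 'I_3 -> 'M[F]_m.

(* V^eps for eps = (sign automorphism s) o (permutation sg):
   generator j acts by s(sg j) * (generator sg j) *)
Definition twist (s : 'I_3 -> F) (sg : {perm 'I_3}) m (A : bimx m) : bimx m :=
  fun j => s (sg j) *: A (sg j).

Definition aut_p1m1 (j : 'I_3) : F := nth 0 [:: 1; -1; -1] j.
Definition aut_m1p1 (j : 'I_3) : F := nth 0 [:: -1; 1; -1] j.
Definition aut_m1m1 (j : 'I_3) : F := nth 0 [:: -1; -1; 1] j.

Definition perm13 : {perm 'I_3} := tperm ord0 (inord 2).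
Definition perm132 : {perm 'I_3} := tperm (inord 1) (inord 2) * tperm ord0 (inord 2).

Definition dsum2 m (A : bimx m) : bimx (m + m) :=
  fun j => block_mx (A j) 0 0 (A j).

Definition Otheta (d : nat) (a : F) (i : nat) : F :=
  (-1) ^+ i * (2 * a - d%:R + 2 * i%:R) / 2.
Definition Ophi (d : nat) (a b c : F) (i : nat) : F :=
  if ~~ odd i then i%:R * (d.+1%:R - 2 * i%:R - 2 * a - 2 * b - 2 * c) / 2
  else (i%:R - d.+1%:R) * (d.+1%:R - 2 * i%:R - 2 * a - 2 * b + 2 * c) / 2.
Definition OX (d : nat) (a : F) : 'M[F]_d.+1 :=
  \matrix_(r, s) (if r == s :> nat then Otheta d a r
                  else if r == s.+1 :> nat then 1 else 0).
Definition OY (d : nat) (a b c : F) : 'M[F]_d.+1 :=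
  \matrix_(r, s) (if r == s :> nat then Otheta d b r
                  else if s == r.+1 :> nat then Ophi d a b c s else 0).
Definition Omod (d : nat) (a b c : F) : bimx d.+1 :=
  fun j => match val j with
           | 0 => OX d a
           | 1 => OY d a b c
           | _ => OX d a *m OY d a b c + OY d a b c *m OX d a
                  - (2 * a * b - c * d.+1%:R)%:M
           end.

Definition mx_iso m (A B : bimx m) : Prop :=
  exists2 P : 'M[F]_m, P \in unitmx & forall j, P *m A j = B j *m P.

(* irreducibility: no invariant subspace other than 0 and F^m
   (subspaces of column vectors encoded as row spaces of transposes) *)
Definition mx_irr m (A : bimx m) : Prop :=
  forall U : 'M[F]_m, (forall j, (U *m (A j)^T <= U)%MS) ->
    (U <= (0 : 'M[F]_m))%MS || row_full U.

Variable V : lmodType F.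

Definition submod (ops : 'I_3 -> V -> V) (S : pred V) : Prop :=
  [/\ 0 \in S,
      (forall a u v, u \in S -> v \in S -> a *: u + v \in S) &
      (forall j u, u \in S -> ops j u \in S)].

Definition iso_mx (ops : 'I_3 -> V -> V) (S : pred V) m (A : bimx m) : Prop :=
  submod ops S /\
  exists phi : V -> 'cV[F]_m,
    [/\ (forall a u v, u \in S -> v \in S -> phi (a *: u + v) = a *: phi u + phi v),
        {in S &, injective phi},
        (forall w, exists2 u, u \in S & phi u = w) &
        (forall j u, u \in S -> phi (ops j u) = A j *m phi u)].

(* the quotient S / U of submodules U <= S of V is isomorphic to (F^m, A):
   there is a module epimorphism S -> F^m with kernel U *)
Definition quot_iso (ops : 'I_3 -> V -> V) (S U : pred V) m (A : bimx m) : Prop :=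
  [/\ submod ops S, submod ops U, {subset U <= S} &
  exists phi : V -> 'cV[F]_m,
    [/\ (forall a u v, u \in S -> v \in S -> phi (a *: u + v) = a *: phi u + phi v),
        (forall u, u \in S -> (phi u == 0) = (u \in U)),
        (forall w, exists2 u, u \in S & phi u = w) &
        (forall j u, u \in S -> phi (ops j u) = A j *m phi u)]].

End MatrixModules.

Arguments aut_p1m1 {F} j.
Arguments aut_m1p1 {F} j.
Arguments aut_m1m1 {F} j.

(* Main.v *)
Require Import Defs.
From HB Require Import structures.
From mathcomp Require Import all_boot all_order all_algebra all_fingroup.
From mathcomp Require Import reals complex mpoly.
From mathcomp Require Import ring zify.
Import Order.TTheory GRing.Theory Num.Theory.
Local Open Scope ring_scope.

Set Implicit Arguments.
Unset Strict Implicit.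
Unset Printing Implicit Defensive.

(* Diagonalizing [e_1] and restricting to [x_1 = 0] (a Cauchy-Kovalevskaya extension,
   possible because [n < t_1]) identifies [Mn] with two copies of the forms of degree
   [n] in [x_2, x_3]. On the monomials [x_2^y x_3^z], [Y] and [Z] act by opposite
   bidiagonal matrices and [X] is determined by [Y Z + Z Y = X + lamX]; since
   [T_2 x_2^(t_2) = 0] and [T_3 x_3^(t_3) = 0], the submodules and quotients of the
   theorem are windows of this line of monomials, and after rescaling the monomials
   their matrices are those of [W1], [W2], [W3].

   For [k_1 >= 0] irreducibility follows from the nonvanishing of the [varphi_i] of
   both split bases. The isomorphisms between twists are homomorphisms out of the
   irreducible modules, each determined by the image of [v_0]: an eigenvector of [Y]
   satisfying one further equation. *)

(** There are two copies because at x_1 = 0 the Dirac equation trades the coefficient of x_1 in one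
    [e_1]-component for coefficients of the other one; after this substitution [Y] and [Z] preserve
    each component. Evenness of [n] makes (-1)^y and (-1)^z agree on the line y + z = n. The
    parameters of the modules are read off this line: [a] and [b] from the diagonals, [c] from the
    products of opposite off-diagonal entries, and 2ab - c(d+1) must be the constant [- lamX]. For
    the final isomorphisms a nonzero homomorphism is enough, by Schur's lemma. The obstacle is the
    eigenvector that receives v_0. It comes for free, as the first or the last one of a bidiagonal
    matrix, when the generator [Y] is preserved up to sign; this settles W_1 and W_2. For W_3 a
    3-cycle remains, and v_0 must go to an eigenvector of the tridiagonal [Z], which is built by
    hand in [O_rotation]. The assumption k_1 >= 0 keeps 2b away from the odd integers up to d + 1 in
    absolute value, so that the relevant eigenvalues of [Y] stay separated. *)

Lemma signr_odd2 (F : pzRingType) (i : nat) :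
  (-1) ^+ i = (if odd i then -1 else 1) :> F.
Proof. by rewrite -signr_odd; case: odd; rewrite ?expr1 ?expr0. Qed.

(* The diagonal entries of [Z], tridiagonal in the basis of [Omod]. *)
Definition Ozeta (F : fieldType) (d : nat) (c : F) (i : nat) : F :=
  if odd i then - (c + d%:R / 2 + 1) else c + d%:R / 2.

Ltac parity i :=
  rewrite /Otheta /Ophi /Ozeta ?signr_odd2 /= ?negbK; case: (odd i) => /=;
  rewrite -?natr1 ?mulr0n; try (by field).

(** * Irreducibility of the modules O_d(a,b,c) *)

Section OModule.
Variable F : numFieldType.
Variable d : nat.

(** Indexed by all naturals and zero beyond [d], so that the bidiagonal formulas hold at the last
    index without a separate case. *)
Definition ebase (i : nat) : 'cV[F]_d.+1 := \col_j ((j : nat) == i)%:R.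

Lemma mul_ebase m (A : 'M[F]_(m, d.+1)) i (lt_i_d : (i < d.+1)%N) :
  A *m ebase i = col (Ordinal lt_i_d) A.
Proof.
apply/colP => r; rewrite !mxE (bigD1 (Ordinal lt_i_d)) //= mxE eqxx mulr1.
rewrite big1 ?addr0 // => j; rewrite -val_eqE /= mxE => /negPf ->.
by rewrite mulr0.
Qed.

Lemma ebase_out i : (d < i)%N -> ebase i = 0.
Proof.
move=> lt_d_i; apply/colP => r; rewrite !mxE.
by case: eqP => // r_i; have := ltn_ord r; rewrite r_i ltnS leqNgt lt_d_i.
Qed.

Lemma eq_ebase m (A B : 'M[F]_(m, d.+1)) :
  (forall i, (i <= d)%N -> A *m ebase i = B *m ebase i) -> A = B.
Proof.
move=> AB; apply/matrixP => r j; have:= AB j (ltn_ord j).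
rewrite (mul_ebase A (ltn_ord j)) (mul_ebase B (ltn_ord j)) => /colP/(_ r).
by rewrite !mxE; congr (A _ _ = B _ _); exact: val_inj.
Qed.

Lemma OX_ebase a i : OX d a *m ebase i = Otheta d a i *: ebase i + ebase i.+1.
Proof.
have [le_i_d|lt_d_i] := leqP i d; last first.
  by rewrite !ebase_out ?mulmx0 ?scaler0 ?addr0 // ltnW.
rewrite (@mul_ebase _ _ _ (le_i_d : (i < d.+1)%N)); apply/colP => r; rewrite !mxE /=.
case: (eqVneq (r : nat) i) => [->|ne]; first by rewrite mulr1 (ltn_eqF (leqnn _)) addr0.
by rewrite mulr0 add0r; case: eqP.
Qed.

Hypothesis even_d : ~~ odd d.

Lemma Ophi_0 (a b c : F) : Ophi d a b c 0 = 0.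
Proof. by rewrite /Ophi /= !mul0r. Qed.

(** As [d] is even, [d.+1] falls in the odd branch, whose factor i - (d+1) vanishes there. With
    [Ophi_0] this closes both ends of the recursions. *)
Lemma Ophi_last (a b c : F) : Ophi d a b c d.+1 = 0.
Proof. by rewrite /Ophi /= even_d subrr !mul0r. Qed.

Lemma OY_ebase (a b c : F) i :
  OY d a b c *m ebase i = Otheta d b i *: ebase i + Ophi d a b c i *: ebase i.-1.
Proof.
have [le_i_d|] := leqP i d; last first.
  rewrite leq_eqVlt => /predU1P[<-|lt_d_i].
    by rewrite Ophi_last scale0r addr0 ebase_out ?mulmx0 ?scaler0.
  have lt_d_i1 : (d < i.-1)%N by case: i lt_d_i.
  by rewrite !ebase_out ?mulmx0 ?scaler0 ?addr0 // ltnW.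
rewrite (@mul_ebase _ _ _ (le_i_d : (i < d.+1)%N)); apply/colP => r; rewrite !mxE /=.
case: i le_i_d => [|i] le_i_d /=.
  by rewrite Ophi_0 mul0r addr0; case: (eqVneq (r : nat) 0%N) => [->|_]; rewrite ?mulr1 ?mulr0.
case: (eqVneq (r : nat) i.+1) => [->|ne].
  by rewrite mulr1 (gtn_eqF (leqnn _)) mulr0 addr0.
rewrite mulr0 add0r eqSS [i == _]eq_sym.
by case: eqP; rewrite ?mulr1 ?mulr0.
Qed.

Lemma Otheta_SS (a : F) i : Otheta d a i.+2 = Otheta d a i + 2 * (-1) ^+ i.
Proof. parity i. Qed.


Definition OZ (a b c : F) : 'M[F]_d.+1 :=
  OX d a *m OY d a b c + OY d a b c *m OX d a - (2 * a * b - c * d.+1%:R)%:M.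

(** Consecutive values of [Otheta] at i and i+1 add up to -(-1)^i, whatever the parameter; this
    reduces the off-diagonal entries of the anticommutator to a sign and to a sign times [Ophi]. *)
Lemma OZ_ebase (a b c : F) i :
  OZ a b c *m ebase i = - (-1) ^+ i *: ebase i.+1 + Ozeta d c i *: ebase i
    + ((-1) ^+ i * Ophi d a b c i) *: ebase i.-1.
Proof.
rewrite /OZ mulmxBl mulmxDl -!mulmxA OX_ebase OY_ebase !mulmxDr -!scalemxAr.
rewrite !OX_ebase !OY_ebase mul_scalar_mx /=.
case: i => [|i] /=.
  rewrite Ophi_0.
  move: (ebase 0) (ebase 1) => u v; apply/colP => r; rewrite !mxE.
  by rewrite /Otheta /Ophi /Ozeta /= -?natr1; field.
move: (ebase i) (ebase i.+1) (ebase i.+2) => u v w; apply/colP => r; rewrite !mxE.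
by parity i.
Qed.

(** Together with [OZX_rel], the relations of BI that do not hold by definition of [OZ]. The three
    scalars are cyclic images of 2ab - c(d+1) under a -> b -> c -> a, the symmetry that [O_rotation]
    realizes on modules. *)
Lemma OYZ_rel (a b c : F) :
  OY d a b c *m OZ a b c + OZ a b c *m OY d a b c =
  OX d a + (2 * b * c - a * d.+1%:R)%:M.
Proof.
have := OZ_ebase a b c; move: (OZ a b c) => Z Z_e.
apply: eq_ebase => i _; rewrite !mulmxDl -!mulmxA ?OY_ebase Z_e OX_ebase.
rewrite !mulmxDr -!scalemxAr !OY_ebase !Z_e mul_scalar_mx.
case: i => [|[|i]] /=.
- rewrite !Ophi_0; move: (ebase 0) (ebase 1) => u v; apply/colP => r; rewrite !mxE.
  by rewrite /Otheta /Ophi /Ozeta /= -?natr1; field.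
- rewrite !Ophi_0; move: (ebase 0) (ebase 1) (ebase 2) => u v w; apply/colP => r; rewrite !mxE.
  by rewrite /Otheta /Ophi /Ozeta /= -?natr1; field.
move: (ebase i) (ebase i.+1) (ebase i.+2) (ebase i.+3) => t u v w.
apply/colP => r; rewrite !mxE.
by parity i.
Qed.

Lemma OZX_rel (a b c : F) :
  OZ a b c *m OX d a + OX d a *m OZ a b c =
  OY d a b c + (2 * c * a - b * d.+1%:R)%:M.
Proof.
have := OZ_ebase a b c; move: (OZ a b c) => Z Z_e.
apply: eq_ebase => i _; rewrite !mulmxDl -!mulmxA ?OY_ebase Z_e OX_ebase.
rewrite !mulmxDr -!scalemxAr !OX_ebase !Z_e mul_scalar_mx.
case: i => [|i] /=.
- rewrite !Ophi_0; move: (ebase 0) (ebase 1) (ebase 2) => u v w; apply/colP => r; rewrite !mxE.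
  by rewrite /Otheta /Ophi /Ozeta /= -?natr1; field.
move: (ebase i) (ebase i.+1) (ebase i.+2) (ebase i.+3) => t u v w.
apply/colP => r; rewrite !mxE.
by parity i.
Qed.

Section Irreducible.
Variables a b c : F.

(** Row vectors are used because [mx_irr] encodes subspaces as row spaces on which the transposed
    matrices act. *)
Definition ecoord (w : 'rV[F]_d.+1) i : F := (w *m ebase i) 0 0.

Lemma ecoord_out w i : (d < i)%N -> ecoord w i = 0.
Proof. by move=> lt_d_i; rewrite /ecoord ebase_out // mulmx0 mxE. Qed.

Lemma ecoord_eq0 w : (forall i, ecoord w i = 0) -> w = 0.
Proof.
move=> w0; apply/rowP => j; have := w0 j.
rewrite /ecoord (mul_ebase w (ltn_ord j)) !mxE => <-.
by congr (w _ _); apply: val_inj.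
Qed.

Lemma ecoordB w w' i : ecoord (w - w') i = ecoord w i - ecoord w' i.
Proof. by rewrite /ecoord mulmxBl !mxE. Qed.

Lemma ecoordZ x w i : ecoord (x *: w) i = x * ecoord w i.
Proof. by rewrite /ecoord -scalemxAl !mxE. Qed.

Lemma ecoord_OX0 w : ecoord (w *m (OX d a)^T) 0 = Otheta d a 0 * ecoord w 0.
Proof.
rewrite /ecoord -mulmxA (mul_ebase _ (ltn0Sn d)).
have -> : col (Ordinal (ltn0Sn d)) (OX d a)^T = Otheta d a 0 *: ebase 0.
  apply/colP => j; rewrite !mxE /=.
  by case: j => -[|j] //= _; rewrite ?mulr1 ?mulr0.
by rewrite -scalemxAr !mxE.
Qed.

Lemma ecoord_OX w i : (i < d)%N ->
  ecoord (w *m (OX d a)^T) i.+1 = Otheta d a i.+1 * ecoord w i.+1 + ecoord w i.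
Proof.
move=> lt_i_d; rewrite /ecoord -mulmxA (mul_ebase _ (lt_i_d : (i.+1 < d.+1)%N)).
have -> : col (Ordinal (lt_i_d : (i.+1 < d.+1)%N)) (OX d a)^T =
          Otheta d a i.+1 *: ebase i.+1 + ebase i.
  apply/colP => j; rewrite !mxE /= eqSS [i == _]eq_sym [_ == (j : nat)]eq_sym.
  case: (eqVneq (j : nat) i.+1) => [->|ne]; first by rewrite mulr1 gtn_eqF ?addr0.
  by rewrite mulr0 add0r; case: eqP.
by rewrite mulmxDr -scalemxAr !mxE.
Qed.

Lemma ecoord_OY w i :
  ecoord (w *m (OY d a b c)^T) i =
  Otheta d b i * ecoord w i + Ophi d a b c i.+1 * ecoord w i.+1.
Proof.
have [le_i_d|lt_d_i] := leqP i d; last first.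
  by rewrite !ecoord_out ?mulr0 ?addr0 // ltnW.
rewrite /ecoord -mulmxA (mul_ebase _ (le_i_d : (i < d.+1)%N)).
have -> : col (Ordinal (le_i_d : (i < d.+1)%N)) (OY d a b c)^T =
          Otheta d b i *: ebase i + Ophi d a b c i.+1 *: ebase i.+1.
  apply/colP => j; rewrite !mxE /= [i == _]eq_sym.
  case: (eqVneq (j : nat) i) => [->|ne].
    by rewrite mulr1 (ltn_eqF (leqnn _)) mulr0 addr0.
  rewrite mulr0 add0r; case: eqP => [->|_]; by rewrite ?mulr1 ?mulr0.
by rewrite mulmxDr -!scalemxAr !mxE.
Qed.

(** For a [Y]-eigenvector with top coordinate 1 at index [m], [p] and [q] are the two coordinates
    below it. The equations are coordinates m-1 and m-2 of the eigenvector equation, and coordinate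
    m-1 of the proportionality obtained by applying [X]. Eliminating [p] and [q] leaves a product of
    explicit factors. *)
Lemma O_irr_factor m (p q : F) : (0 < m)%N -> (m <= d)%N ->
  2 * b - d%:R + 2 * m%:R - 1 != 0 ->
  Ophi d a b c m + (Otheta d b m.-1 - Otheta d b m) * p = 0 ->
  Ophi d a b c m.-1 * p = 2 * (-1) ^+ m * q ->
  (Otheta d a m + p) * Ophi d a b c m
    + (p * Otheta d a m.-1 + q) * (Otheta d b m.-1 - Otheta d b m.+1) =
  (Ophi d a b c m.+1 + (Otheta d a m + p) * (Otheta d b m - Otheta d b m.+1)) * p ->
  Ophi d a b c m * (if odd m then 2 * b + m%:R else 2 * b - (d.+1 - m)%:R) * 
  (d.+1%:R - 2 * (d.+1 - m)%:R - 2 * a + 2 * b + (if odd m then 2 else -2) * c) = 0.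
Proof.
case: m => // m _ le_m_d /= nz Ep Eq E.
have {}Eq : q = (-1) ^+ m.+1 * Ophi d a b c m * p / 2.
  rewrite -[LHS]mul1r; rewrite -(mulrA _ _ p) Eq signr_odd2.
  by case: odd; field.
have {}Ep : p = Ophi d a b c m.+1 / ((-1) ^+ m.+1 * (2 * b - d%:R + 2 * m.+1%:R - 1)).
  apply: (@mulIf _ (Otheta d b m - Otheta d b m.+1)).
    have -> : Otheta d b m - Otheta d b m.+1 =
              (-1) ^+ m * (2 * b - d%:R + 2 * m.+1%:R - 1) by parity m.
    by rewrite mulf_neq0 ?signr_eq0.
  rewrite mulrC; move/eqP: Ep; rewrite addrC addr_eq0 => /eqP ->.
  have -> : Otheta d b m - Otheta d b m.+1 =
              (-1) ^+ m * (2 * b - d%:R + 2 * m.+1%:R - 1) by parity m.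
  rewrite exprS; field.
  by rewrite nat1r nz signr_eq0.
move: E; rewrite Eq Ep {Eq Ep p q} (natrB _ (leqW le_m_d)) => /eqP; rewrite -subr_eq0 => /eqP E.
apply/eqP; rewrite -[X in X == 0]mulr1.
(* Substituting [p] and [q] leaves the square of this gap as denominator in [E], so the claim is
   compared with [E] after multiplication by it. *)
rewrite -[X in _ * X](@divff _ ((2 * b - d%:R + 2 * m.+1%:R - 1) ^+ 2)); last by rewrite expf_neq0.
apply/eqP; transitivity ((-1) ^+ m.+1 * (2 * b - d%:R + 2 * m.+1%:R - 1) ^+ 2 * 0 : F); last by rewrite mulr0.
rewrite -[in RHS]E; move: nz {E}; rewrite /Otheta /Ophi !signr_odd2 /= !negbK.
case: (odd m) => /=; rewrite -!natr1 => nz; field; by rewrite add0r in nz.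
Qed.

Hypothesis b_sep : forall e, odd e -> (e <= d)%N ->
  (2 * b + e%:R != 0) && (2 * b - e%:R != 0).
Hypothesis phi_neq0 : forall i, (0 < i <= d)%N -> Ophi d a b c i != 0.
(* [Ophi d a (- b) (- c)] plays the role of [phi] for the split basis that
   starts at the other end of the spectrum of [Y]. *)
Hypothesis phi'_neq0 : forall i, (0 < i <= d)%N -> Ophi d a (- b) (- c) i != 0.

(** Up to sign this is the difference of the eigenvalues of [Y] with indices m-1 and m. As [d] is
    even, 2m - 1 - d is odd, and it is at most [d] in absolute value, so [b_sep] applies on either
    side. *)
Lemma gap_neq0 m : (0 < m <= d)%N -> 2 * b - d%:R + 2 * m%:R - 1 != 0.
Proof.
case: m => // m /= lt_m_d.
have dbl : m.*2.+1%:R = 2 * m%:R + 1 :> F by rewrite -natr1 -mul2n natrM.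
have [le_d_2m|] := leqP d (m.*2.+1).
  have od : odd (m.*2.+1 - d) by rewrite oddB //= odd_double (negPf even_d).
  have le : (m.*2.+1 - d <= d)%N by rewrite leq_subLR; move: lt_m_d; rewrite -addnn; lia.
  have /andP[+ _] := b_sep od le; rewrite natrB // dbl.
  have ->: 2 * b + (2 * m%:R + 1 - d%:R) = 2 * b - d%:R + 2 * m.+1%:R - 1.
    by rewrite -(natr1 m); ring.
  by [].
move=> lt; have od : odd (d - m.*2.+1).
  by rewrite oddB ?(ltnW lt) //= odd_double (negPf even_d).
have /andP[_] := b_sep od (leq_subr _ _); rewrite natrB ?(ltnW lt) // dbl.
have -> // : 2 * b - (d%:R - (2 * m%:R + 1)) = 2 * b - d%:R + 2 * m.+1%:R - 1.
by rewrite -(natr1 m); ring.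
Qed.

(** The last factor is, up to a nonzero scalar, the linear factor of [Ophi d a (- b) (- c)] at the
    reflected index d + 1 - m, whose parity is opposite to that of [m]. *)
Lemma O_irr_factor_neq0 m : (0 < m <= d)%N ->
  Ophi d a b c m * (if odd m then 2 * b + m%:R else 2 * b - (d.+1 - m)%:R) * 
  (d.+1%:R - 2 * (d.+1 - m)%:R - 2 * a + 2 * b + (if odd m then 2 else -2) * c) != 0.
Proof.
move=> m_in; have /andP[m_gt0 le_m_d] := m_in.
have m'_in : (0 < d.+1 - m <= d)%N by lia.
have /andP[_ le_m'_d] := m'_in.
have om' : odd (d.+1 - m) = ~~ odd m by rewrite oddB ?leqW //= even_d.
rewrite !mulf_neq0 ?phi_neq0 //.
  case: ifP => om; first by have /andP[] := b_sep om le_m_d.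
  by have /andP[] := b_sep (etrans om' (negbT om)) le_m'_d.
move: (phi'_neq0 m'_in); apply: contra => /eqP E; apply/eqP.
rewrite /Ophi om' negbK; move: E; case: (odd m) => E.
  transitivity ((d.+1 - m)%:R * 0 / 2 : F); last by rewrite mulr0 mul0r.
  by rewrite -[in RHS]E; field.
transitivity (((d.+1 - m)%:R - d.+1%:R) * 0 / 2 : F); last by rewrite mulr0 mul0r.
by rewrite -[in RHS]E; field.
Qed.

(* A nonzero submodule avoiding [v_0] would contain a vector with minimal top
   ecoordinate [m > 0]; it is a [Y]-eigenvector [y], and by minimality
   [(Y - theta*_(m+1)) X y] is a multiple of [y], which [O_irr_factor] forbids. *)
Lemma O_irr (U : 'M[F]_d.+1) :
  (U *m (OX d a)^T <= U)%MS -> (U *m (OY d a b c)^T <= U)%MS ->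
  (U <= (0 : 'M[F]_d.+1))%MS || row_full U.
Proof.
move=> UX UY.
have X_in (w : 'rV_d.+1) : (w <= U)%MS -> (w *m (OX d a)^T <= U)%MS.
  by move=> wU; apply: submx_trans UX; apply: submxMr.
have Y_in (w : 'rV_d.+1) : (w <= U)%MS -> (w *m (OY d a b c)^T <= U)%MS.
  by move=> wU; apply: submx_trans UY; apply: submxMr.
have B_in (w w' : 'rV_d.+1) x : (w <= U)%MS -> (w' <= U)%MS -> (w - x *: w' <= U)%MS.
  by move=> wU w'U; rewrite addmx_sub // -scaleNr scalemx_sub.
case: (boolP ((ebase 0)^T <= U)%MS) => [e0U|e0nU].
  apply/orP; right; rewrite -sub1mx; apply/row_subP => i.
  have -> : row i 1%:M = (ebase i)^T.
    by apply/rowP => j; rewrite !mxE eq_sym.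
  elim: (val i) => // k IHk.
  have := B_in _ _ (Otheta d a k) (X_in _ IHk) IHk.
  by rewrite -trmx_mul OX_ebase linearD linearZ /= addrAC subrr add0r.
apply/orP; left; apply/row_subP => i.
suffices triv m (w : 'rV_d.+1) : (w <= U)%MS ->
    (forall j, (m <= j)%N -> ecoord w j = 0) -> w = 0.
  rewrite (triv d.+1 (row i U)) ?sub0mx ?row_sub // => j lt_d_j.
  exact: ecoord_out.
elim: m w => [|m IHm] w wU w_top; first by apply: ecoord_eq0 => j; exact: w_top.
have [wm0|wm_neq0] := eqVneq (ecoord w m) 0.
  apply: IHm => // j; rewrite leq_eqVlt => /predU1P[<- //|]; exact: w_top.
exfalso.
have le_m_d : (m <= d)%N.
  by rewrite leqNgt; apply: contra wm_neq0 => /ecoord_out ->.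
pose y := (ecoord w m)^-1 *: w.
have yU : (y <= U)%MS by rewrite scalemx_sub.
have ym : ecoord y m = 1 by rewrite ecoordZ mulVf.
have y_top j : (m < j)%N -> ecoord y j = 0 by move=> /w_top E; rewrite ecoordZ E mulr0.
have yY : y *m (OY d a b c)^T - Otheta d b m *: y = 0.
  apply: IHm => [|j]; first by rewrite B_in // Y_in.
  rewrite leq_eqVlt => /predU1P[<-|lt_m_j]; rewrite ecoordB ecoordZ ecoord_OY.
    by rewrite (y_top m.+1) // mulr0 addr0 subrr.
  by rewrite !y_top ?mulr0 ?addr0 ?subr0 // ltnW.
clearbody y; clear w wU w_top wm_neq0.
case: m => [|m] in IHm le_m_d ym y_top yY *.
  case/negP: e0nU; suffices <- : y = (ebase 0)^T by [].
  apply/eqP; rewrite -subr_eq0; apply/eqP; apply: ecoord_eq0 => j; rewrite ecoordB.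
  have -> : ecoord (ebase 0)^T j = (j == 0%N)%:R.
    have [le_j_d|lt_d_j] := leqP j d; last by rewrite ecoord_out //; case: j lt_d_j.
    by rewrite /ecoord (mul_ebase _ (le_j_d : (j < d.+1)%N)) !mxE.
  by case: j => [|j]; rewrite ?ym ?y_top // subrr.
have m_in : (0 < m.+1 <= d)%N by [].
have Ep : Ophi d a b c m.+1 + (Otheta d b m - Otheta d b m.+1) * ecoord y m = 0.
  have := congr1 (ecoord^~ m) yY; rewrite ecoordB ecoordZ ecoord_OY ym.
  by rewrite [ecoord 0 m]/ecoord mul0mx mxE => E; rewrite -[RHS]E; ring.
pose q := if m is m'.+1 then ecoord y m' else 0.
have Eq : Ophi d a b c m * ecoord y m = 2 * (-1) ^+ m.+1 * q.
  rewrite /q; case: (m) yY => [|m'] yY'; first by rewrite Ophi_0 mul0r mulr0.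
  have := congr1 (ecoord^~ m') yY'; rewrite ecoordB ecoordZ ecoord_OY Otheta_SS.
  rewrite [ecoord 0 m']/ecoord mul0mx mxE => E; apply/eqP; rewrite -subr_eq0 -[X in _ == X]E.
  by apply/eqP; rewrite !exprS; ring.
have Xy : ecoord (y *m (OX d a)^T) m = Otheta d a m * ecoord y m + q.
  by rewrite /q; case: (m) le_m_d => [|m'] lt; rewrite ?ecoord_OX0 ?addr0 ?ecoord_OX // ltnW.
(* [C] is the coordinate of index [m.+1] of (Y - [Otheta d b m.+2]) X y, whose coordinate of index
   [m.+2] is already zero. Subtracting [C] times [y] therefore leaves a vector of [U] supported
   below [m.+1], which is zero by [IHm]. *)
pose C := Ophi d a b c m.+2 + (Otheta d a m.+1 + ecoord y m) * (Otheta d b m.+1 - Otheta d b m.+2).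
have Xym : ecoord (y *m (OX d a)^T) m.+1 = Otheta d a m.+1 + ecoord y m.
  by rewrite ecoord_OX // ym mulr1.
have Xy_top : Ophi d a b c m.+2 * ecoord (y *m (OX d a)^T) m.+2 = Ophi d a b c m.+2.
  move: le_m_d; rewrite leq_eqVlt => /predU1P[->|lt]; first by rewrite Ophi_last mul0r.
  by rewrite ecoord_OX // y_top // mulr0 add0r ym mulr1.
have Xy_out j : (m.+2 < j)%N -> ecoord (y *m (OX d a)^T) j = 0.
  case: j => // j lt; have [lt_j_d|] := ltnP j d; last by move=> le; apply: ecoord_out.
  by rewrite ecoord_OX // !y_top ?mulr0 ?addr0 // ltnW.
pose z := y *m (OX d a)^T.
have zU : (z <= U)%MS by apply: X_in.
have Ez : z *m (OY d a b c)^T - Otheta d b m.+2 *: z - C *: y = 0.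
  apply: IHm => [|j]; first by rewrite !B_in ?Y_in.
  rewrite !ecoordB !ecoordZ ecoord_OY /z.
  rewrite leq_eqVlt => /predU1P[<-|].
    by rewrite Xym Xy_top ym /C; ring.
  rewrite leq_eqVlt => /predU1P[<-|lt].
    by rewrite (Xy_out m.+3) // (y_top m.+2) // !mulr0 addr0 subrr subr0.
  have [lt1 lt2] : (m.+2 < j.+1)%N /\ (m.+1 < j)%N by split; apply: ltnW.
  by rewrite (Xy_out _ lt) (Xy_out _ lt1) (y_top _ lt2) !mulr0 addr0 !subr0.
have E := congr1 (ecoord^~ m) Ez.
rewrite /= !ecoordB !ecoordZ ecoord_OY /z Xy Xym [ecoord 0 m]/ecoord mul0mx mxE in E.
have := O_irr_factor_neq0 m_in; apply/negP; rewrite negbK; apply/eqP.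
apply: (@O_irr_factor _ (ecoord y m) q) => //; first exact: gap_neq0.
apply/eqP; rewrite -subr_eq0 -[X in _ == X]E; apply/eqP.
by rewrite /C /=; ring.
Qed.

End Irreducible.

End OModule.

(** * Homomorphisms out of O_d(a,b,c) *)

Section Universal.
Variable F : numFieldType.
Variable d : nat.
Hypothesis even_d : ~~ odd d.
Variables a b c : F.
Variable m : nat.
Variables X Y Z : 'M[F]_m.
Hypothesis XY : X *m Y + Y *m X = Z + (2 * a * b - c * d.+1%:R)%:M.
Hypothesis ZX : Z *m X + X *m Z = Y + (2 * c * a - b * d.+1%:R)%:M.


(** Once [Z] is eliminated by [XY], the relation [ZX] applied to [w i] contains [Y *m w i.+2] with
    coefficient 1 and otherwise only known terms. Hence two initial values determine the action of
    [Y] on the whole sequence. *)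
Lemma split_step (w : nat -> 'cV[F]_m) i :
  (forall j, X *m w j = w j.+1 + Otheta d a j *: w j) ->
  Y *m w i = Otheta d b i *: w i + Ophi d a b c i *: w i.-1 ->
  Y *m w i.+1 = Otheta d b i.+1 *: w i.+1 + Ophi d a b c i.+1 *: w i ->
  Y *m w i.+2 = Otheta d b i.+2 *: w i.+2 + Ophi d a b c i.+2 *: w i.+1.
Proof.
move=> Xw Yi Yi1.
have EZ u : Z *m u = X *m (Y *m u) + Y *m (X *m u) - (2 * a * b - c * d.+1%:R) *: u.
  by rewrite !mulmxA -mulmxDl XY mulmxDl mul_scalar_mx addrK.
have XYi : X *m (Y *m w i) = Otheta d b i *: (w i.+1 + Otheta d a i *: w i)
             + Ophi d a b c i *: (w i + Otheta d a i.-1 *: w i.-1).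
  rewrite Yi mulmxDr -!scalemxAr !Xw; case: i {Yi Yi1} => [|i] //=.
  by rewrite (Ophi_0 d) !scale0r.
have XYi1 : X *m (Y *m w i.+1) = Otheta d b i.+1 *: (w i.+2 + Otheta d a i.+1 *: w i.+1)
             + Ophi d a b c i.+1 *: (w i.+1 + Otheta d a i *: w i).
  by rewrite Yi1 mulmxDr -!scalemxAr !Xw.
have XXYi : X *m (X *m (Y *m w i)) =
    Otheta d b i *: (w i.+2 + Otheta d a i.+1 *: w i.+1 + Otheta d a i *: (w i.+1 + Otheta d a i *: w i))
    + Ophi d a b c i *: (w i.+1 + Otheta d a i *: w i
         + Otheta d a i.-1 *: (w i + Otheta d a i.-1 *: w i.-1)).
  rewrite XYi !(mulmxDr, =^~ scalemxAr) !Xw; case: i {Yi Yi1 XYi XYi1} => [|i] //=.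
  by rewrite (Ophi_0 d) !scale0r.
have YXi : Y *m (X *m w i) = Y *m w i.+1 + Otheta d a i *: (Y *m w i).
  by rewrite Xw mulmxDr -scalemxAr.
have YXi1 : Y *m (X *m w i.+1) = Y *m w i.+2 + Otheta d a i.+1 *: (Y *m w i.+1).
  by rewrite Xw mulmxDr -scalemxAr.
have ZXi : Z *m (X *m w i) = X *m (Y *m w i.+1) + Y *m (X *m w i.+1)
      - (2 * a * b - c * d.+1%:R) *: w i.+1
    + Otheta d a i *: (X *m (Y *m w i) + Y *m (X *m w i) - (2 * a * b - c * d.+1%:R) *: w i).
  by rewrite [in LHS]Xw mulmxDr -scalemxAr !EZ.
have XZi : X *m (Z *m w i) = X *m (X *m (Y *m w i))
    + (X *m (Y *m w i.+1) + Otheta d a i *: (X *m (Y *m w i)))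
        - (2 * a * b - c * d.+1%:R) *: (w i.+1 + Otheta d a i *: w i).
  by rewrite EZ YXi mulmxBr !mulmxDr -!scalemxAr Xw.
have : Z *m (X *m w i) + X *m (Z *m w i) = Y *m w i + (2 * c * a - b * d.+1%:R) *: w i.
  by rewrite !mulmxA -mulmxDl ZX mulmxDl mul_scalar_mx.
rewrite {}ZXi {}XZi.
rewrite XXYi YXi1 YXi !XYi !XYi1 !Yi !Yi1.
clear XXYi YXi1 YXi XYi XYi1 Yi Yi1 EZ Xw.
move: (w i.+2) (w i.+1) (w i) (w i.-1) => w2 w1 w0 v; move: (Y *m w2) => y /colP E.
apply/colP => r; move: (E r) => {E}; rewrite !mxE.
move=> /eqP; rewrite -subr_eq0 => /eqP E; apply/eqP; rewrite -subr_eq0 -[X in _ == X]E.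
apply/eqP; case: i E => [|i] _; rewrite ?(Ophi_0 d).
  by rewrite /Otheta /Ophi /= -?natr1; field.
by parity i.
Qed.


(** The forced images of the basis vectors v_i under a homomorphism that sends v_0 to [w0]. *)
Definition split_vec (w0 : 'cV[F]_m) i : 'cV[F]_m :=
  iteri i (fun j u => X *m u - Otheta d a j *: u) w0.

(** The recursion runs past index [d]. Since [Ophi] vanishes at [d.+1], the vector of that index
    satisfies the eigenvector equation in the third hypothesis, which then forces it to vanish, as
    v_(d+1) must. *)
Lemma O_hom (w0 : 'cV[F]_m) :
  Y *m w0 = Otheta d b 0 *: w0 ->
  Y *m split_vec w0 1 = Otheta d b 1 *: split_vec w0 1 + Ophi d a b c 1 *: w0 ->
  (Y *m split_vec w0 d.+1 = Otheta d b d.+1 *: split_vec w0 d.+1 ->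
   split_vec w0 d.+1 = 0) ->
  exists P : 'M[F]_(m, d.+1),
    [/\ P *m OX d a = X *m P, P *m OY d a b c = Y *m P & P *m ebase F d 0 = w0].
Proof.
set w := split_vec w0 => Y0 Y1 w_last.
have Xw j : X *m w j = w j.+1 + Otheta d a j *: w j by rewrite subrK.
have Yw i : Y *m w i = Otheta d b i *: w i + Ophi d a b c i *: w i.-1 /\
    Y *m w i.+1 = Otheta d b i.+1 *: w i.+1 + Ophi d a b c i.+1 *: w i.
  elim: i => [|i [IHi IHi1]]; first by rewrite Ophi_0 scale0r addr0.
  by split=> //; apply: split_step.
have {}w_last : w d.+1 = 0.
  by apply: w_last; rewrite (Yw d).2 (Ophi_last even_d) scale0r addr0.
pose P := \matrix_(r < m, j < d.+1) w j r 0.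
have Pe i : (i <= d)%N -> P *m ebase F d i = w i.
  move=> le_i_d; rewrite (mul_ebase _ (le_i_d : (i < d.+1)%N)).
  by apply/colP => r; rewrite !mxE.
have Pe1 i : (i <= d)%N -> P *m ebase F d i.+1 = w i.+1.
  rewrite leq_eqVlt => /predU1P[->|]; last exact: Pe.
  by rewrite ebase_out // mulmx0 w_last.
exists P; split; last exact: Pe.
  apply: eq_ebase => i le_i_d.
  by rewrite -!mulmxA OX_ebase mulmxDr -scalemxAr (Pe i) // (Pe1 i) // Xw addrC.
apply: eq_ebase => i le_i_d; rewrite -!mulmxA (OY_ebase even_d) mulmxDr -!scalemxAr.
by rewrite !Pe ?(Yw i).1 // (leq_trans (leq_pred i)).
Qed.

Hypothesis YZ : Y *m Z + Z *m Y = X + (2 * b * c - a * d.+1%:R)%:M.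

(* Applied to [w0], the relation [YZ] says that [Y x - theta*_1 x - (...) w0] is
   an eigenvector of [Y] for [1 - theta*_0], where [x = X w0]; and the last
   vector [split_vec w0 d.+1] is one for [theta*_(d+1)]. *)
Lemma O_hom_simple (w0 : 'cV[F]_m) :
  Y *m w0 = Otheta d b 0 *: w0 ->
  (forall u : 'cV[F]_m, Y *m u = (1 - Otheta d b 0) *: u -> u = 0) ->
  (forall u : 'cV[F]_m, Y *m u = Otheta d b d.+1 *: u -> u = 0) ->
  exists P : 'M[F]_(m, d.+1),
    [/\ P *m OX d a = X *m P, P *m OY d a b c = Y *m P & P *m ebase F d 0 = w0].
Proof.
move=> Y0 sep_m1 sep_d1; apply: O_hom => //; last by move/sep_d1.
rewrite /split_vec /=; set x := X *m w0.
have Ez : Z *m w0 = Otheta d b 0 *: x + Y *m x - (2 * a * b - c * d.+1%:R) *: w0.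
  have -> : Z = X *m Y + Y *m X - (2 * a * b - c * d.+1%:R)%:M by rewrite XY addrK.
  by rewrite mulmxBl mulmxDl -!mulmxA Y0 mul_scalar_mx -scalemxAr.
have E : Y *m (Z *m w0) + Z *m (Y *m w0) = x + (2 * b * c - a * d.+1%:R) *: w0.
  by rewrite !mulmxA -mulmxDl YZ mulmxDl mul_scalar_mx.
rewrite Y0 -scalemxAr Ez mulmxBr mulmxDr -!scalemxAr Y0 in E.
(* Modulo [w0], the relation reads ((Y + [Otheta d b 0])^2 - 1) x = 0, with roots [Otheta d b 1] and
   [1 - Otheta d b 0]. The coefficient of [w0] is chosen so that z = 0 is exactly the equation
   required of [split_vec w0 1]. *)
pose z := Y *m x - Otheta d b 1 *: x
  - (Ophi d a b c 1 + Otheta d a 0 * (2 * Otheta d b 0 + 1)) *: w0.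
have /sep_m1 : Y *m z = (1 - Otheta d b 0) *: z.
  rewrite /z !mulmxBr -!scalemxAr Y0; move: E.
  move: (Y *m (Y *m x)) (Y *m x) (x) (w0) => y2 y1 x' u /colP E.
  apply/colP => r; move: (E r) => {E}; rewrite !mxE => /eqP.
  rewrite -subr_eq0 => /eqP E; apply/eqP; rewrite -subr_eq0 -[X in _ == X]E.
  by apply/eqP; rewrite /Otheta /Ophi /= -?natr1; field.
move=> /eqP; rewrite /z -addrA -opprD subr_eq0 => /eqP E1.
rewrite mulmxBr -scalemxAr Y0 E1; apply/colP => r; rewrite !mxE.
by rewrite /Otheta /Ophi /= -?natr1; field.
Qed.

End Universal.

(** * Cyclic permutation of the parameters of O_d(a,b,c) *)

Section Rotation.
Variable F : numFieldType.
Variable d : nat.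
Hypothesis even_d : ~~ odd d.
Variables a b c : F.

Definition ccoord (v : 'cV[F]_d.+1) i := ecoord v^T i.

Lemma ccoord_eq (u v : 'cV[F]_d.+1) :
  (forall i, (i <= d)%N -> ccoord u i = ccoord v i) -> u = v.
Proof.
move=> uv; apply/eqP; rewrite -subr_eq0 -[_ - _]trmxK; apply/eqP.
rewrite [X in X^T](@ecoord_eq0 F d) ?trmx0 // => i.
have [le_i_d|lt_d_i] := leqP i d; last exact: ecoord_out.
by rewrite linearB /= ecoordB -!/(ccoord _ _) uv // subrr.
Qed.

Lemma ccoordD u v i : ccoord (u + v) i = ccoord u i + ccoord v i.
Proof. by rewrite /ccoord /ecoord linearD mulmxDl mxE. Qed.

Lemma ccoordN u i : ccoord (- u) i = - ccoord u i.
Proof. by rewrite /ccoord /ecoord linearN mulNmx mxE. Qed.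

Lemma ccoordZ x v i : ccoord (x *: v) i = x * ccoord v i.
Proof. by rewrite /ccoord linearZ ecoordZ. Qed.

Lemma ccoord_out v i : (d < i)%N -> ccoord v i = 0.
Proof. exact: ecoord_out. Qed.

Lemma ccoord_OX v i : (i <= d)%N ->
  ccoord (OX d a *m v) i = Otheta d a i * ccoord v i + (if i is j.+1 then ccoord v j else 0).
Proof.
by rewrite /ccoord trmx_mul; case: i => [|i] lt; rewrite ?ecoord_OX0 ?addr0 ?ecoord_OX.
Qed.

Lemma ccoord_OY v i :
  ccoord (OY d a b c *m v) i = Otheta d b i * ccoord v i + Ophi d a b c i.+1 * ccoord v i.+1.
Proof. by rewrite /ccoord trmx_mul ecoord_OY. Qed.

Lemma ccoord_OZ v i : (i <= d)%N ->
  ccoord (OZ d a b c *m v) i =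
  (if i is j.+1 then - (-1) ^+ j * ccoord v j else 0) + Ozeta d c i * ccoord v i
  - (-1) ^+ i * Ophi d a b c i.+1 * ccoord v i.+1.
Proof.
move=> le_i_d; rewrite /OZ mulmxBl mulmxDl -!mulmxA mul_scalar_mx.
rewrite ccoordD ccoordN ccoordD ccoordZ ccoord_OX // !ccoord_OY ccoord_OX //.
have -> : Ophi d a b c i.+1 * ccoord (OX d a *m v) i.+1 =
          Ophi d a b c i.+1 * (Otheta d a i.+1 * ccoord v i.+1 + ccoord v i).
  move: le_i_d; rewrite leq_eqVlt => /predU1P[->|lt]; last by rewrite ccoord_OX.
  by rewrite Ophi_last // !mul0r.
case: i le_i_d => [|i] le_i_d.
  by rewrite /Otheta /Ophi /Ozeta /= -?natr1; field.
rewrite ccoord_OY; parity i.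
Qed.

(** Cayley-Hamilton for an upper triangular matrix: the factor of index [k] kills the top coordinate
    of a vector supported on indices up to [k]. That factor must act first whereas [iteri] applies
    it last, hence the commutation [f_comm]. *)
Lemma OY_annihil (v : 'cV[F]_d.+1) :
  iteri d.+1 (fun j u => OY d a b c *m u - Otheta d b j *: u) v = 0.
Proof.
set f := fun j u => _.
have f_comm k j u : f k (iteri j f u) = iteri j f (f k u).
  elim: j => //= j IHj; rewrite -IHj /f !mulmxBr -!scalemxAr.
  move: (iteri j f u) => w; apply/colP => r.
  by rewrite !scalerBr !scalerA (mulrC (Otheta d b k)); rewrite !mxE; ring.
suffices: forall k u, (forall i, (k <= i)%N -> ccoord u i = 0) -> iteri k f u = 0.
  by apply=> i; apply: ccoord_out.
elim=> [|k IHk] u u_top /=.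
  apply: ccoord_eq => i _.
  by rewrite u_top // /ccoord /ecoord trmx0 mul0mx mxE.
rewrite f_comm; apply: IHk => i le_k_i.
rewrite /f ccoordD ccoordN ccoordZ ccoord_OY (u_top i.+1) // mulr0 addr0.
move: le_k_i; rewrite leq_eqVlt => /predU1P[->|lt_k_i]; first by rewrite subrr.
by rewrite u_top // !mulr0 subrr.
Qed.

Let low j : F :=
  if odd j then - (j.+1)%:R else - (d.+1%:R / 2 - a - b + c - j.+1%:R).
Let high j : F :=
  if odd j then - (d.+1%:R / 2 - a - b - c - j.+1%:R) else d%:R - j%:R.

(* The factorization [Ophi = high * low] is chosen so that the eigenvector [wZ]
   of the tridiagonal [OZ] for [c - d/2] has product entries. *)
Let wZ : 'cV[F]_d.+1 := \col_(j < d.+1) \prod_(j <= i < d) low i.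

Let ccoord_wZ i : (i <= d)%N -> ccoord wZ i = \prod_(i <= k < d) low k.
Proof.
by move=> le_i_d; rewrite /ccoord /ecoord (mul_ebase _ (le_i_d : (i < d.+1)%N)) !mxE.
Qed.

Let wZ_low i : (i < d)%N -> ccoord wZ i = low i * ccoord wZ i.+1.
Proof. by move=> lt; rewrite !ccoord_wZ ?(ltnW lt) // big_ltn. Qed.

Let wZ_high i : (i <= d)%N -> Ophi d a b c i.+1 * ccoord wZ i.+1 = high i * ccoord wZ i.
Proof.
rewrite leq_eqVlt => /predU1P[->|lt].
  by rewrite Ophi_last // /high (negPf even_d) subrr !mul0r.
rewrite (wZ_low lt) mulrA; congr (_ * _); rewrite /high /low.
by parity i.
Qed.

(** A homomorphism from O_d(b,c,a) with X -> Y and Y -> Z must send v_0 to an eigenvector of [OZ]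
    for c - d/2, which is [wZ]. The parameters are arbitrary, so the hypotheses of [O_hom] are
    verified on coordinates, the last one through [OY_annihil]. *)
Lemma O_rotation : exists2 P : 'M[F]_d.+1, P != 0 &
  P *m OX d b = OY d a b c *m P /\ P *m OY d b c a = OZ d a b c *m P.
Proof.
have Zw : OZ d a b c *m wZ = Otheta d c 0 *: wZ.
  apply: ccoord_eq => i le_i_d; rewrite ccoord_OZ // -mulrA wZ_high // ccoordZ.
  case: i le_i_d => [|i] le_i_d; last rewrite (wZ_low le_i_d); rewrite /high /low.
    by rewrite /Otheta /Ozeta /= -?natr1; field.
  parity i.
(* By [wZ_high], [OY] multiplies each coordinate of [wZ] by [Otheta d b i + high i]; after
   subtraction of [Otheta d b 0] this depends only on the parity of [i]. *)
have w1E i : (i <= d)%N -> ccoord (split_vec d b (OY d a b c) wZ 1) i =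
    (if odd i then d.+1%:R / 2 + a - b + c else d%:R) * ccoord wZ i.
  move=> le_i_d; rewrite /split_vec /= ccoordD ccoordN ccoordZ ccoord_OY wZ_high //.
  by rewrite /high; parity i.
case: (@O_hom F d even_d b c a _ _ _ _ (OYZ_rel even_d a b c) _ wZ).
- by rewrite /OZ subrK.
- exact: Zw.
- apply: ccoord_eq => i le_i_d; rewrite ccoord_OZ // [in RHS]ccoordD !ccoordZ -[(-1) ^+ i * _ * _]mulrA.
  have -> : Ophi d a b c i.+1 * ccoord (split_vec d b (OY d a b c) wZ 1) i.+1 =
     (if odd i then d%:R else d.+1%:R / 2 + a - b + c) * (high i * ccoord wZ i).
    rewrite -wZ_high //; move: le_i_d; rewrite leq_eqVlt => /predU1P[->|lt].
      by rewrite Ophi_last // !mul0r mulr0.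
    by rewrite w1E //= if_neg mulrCA.
  case: i le_i_d => [|i] le_i_d; rewrite ?w1E ?(ltnW le_i_d) // ?(wZ_low le_i_d) /low /high.
    by rewrite /Otheta /Ophi /Ozeta /= -?natr1; field.
  by parity i.
- by move=> _; exact: OY_annihil.
move=> P [PX PY Pe]; exists P; last by [].
apply: contraTneq isT => P0; move: Pe; rewrite P0 mul0mx => /esym w0.
have := ccoord_wZ (leqnn d); rewrite w0 big_geq // /ccoord /ecoord trmx0 mul0mx mxE.
by move/eqP; rewrite eq_sym oner_eq0.
Qed.

End Rotation.

(** * Schur's lemma and the twists in matrix form *)

Section Twists.
Variable F : numFieldType.

(** Schur's lemma: the kernel, encoded as the left kernel of [P^T], is a submodule of [A]; it is not
    everything as [P] is nonzero, hence it is zero. *)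
Lemma iso_of_hom m (A B : bimx F m) (P : 'M[F]_m) :
  mx_irr A -> P != 0 -> (forall j, P *m A j = B j *m P) -> P \in unitmx.
Proof.
move=> irrA P0 PA.
have ker_inv j : (kermx P^T *m (A j)^T <= kermx P^T)%MS.
  apply/sub_kermxP.
  by rewrite -mulmxA -trmx_mul PA trmx_mul mulmxA mulmx_ker mul0mx.
case/orP: (irrA _ ker_inv).
  rewrite submx0 => /eqP kerP0; rewrite -unitmx_tr -row_free_unit.
  by rewrite -kermx_eq0 kerP0.
rewrite -sub1mx => /sub_kermxP; rewrite mul1mx => /(congr1 trmx).
by rewrite trmxK trmx0 => P0'; rewrite P0' eqxx in P0.
Qed.

Lemma mx_irr_twist (s : 'I_3 -> F) (sg : {perm 'I_3}) m (A : bimx F m) :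
  (forall j, s j != 0) -> mx_irr A -> mx_irr (twist s sg A).
Proof.
move=> s_neq0 irrA U U_inv; apply: irrA => j; have := U_inv (sg^-1%g j).
by rewrite /twist permKV linearZ /= -scalemxAr eqmx_scale.
Qed.

Lemma ord3P (P : 'I_3 -> Prop) :
  P ord0 -> P (inord 1) -> P (inord 2) -> forall j, P j.
Proof.
move=> P0 P1 P2; case=> -[|[|[|//]]] lt_j.
- by have -> : Ordinal lt_j = ord0 by exact: val_inj.
- by have -> : Ordinal lt_j = inord 1 by apply: val_inj; rewrite /= inordK.
- by have -> : Ordinal lt_j = inord 2 by apply: val_inj; rewrite /= inordK.
Qed.

Let ne01 : (ord0 : 'I_3) != inord 1. Proof. by rewrite -val_eqE /= inordK. Qed.
Let ne02 : (ord0 : 'I_3) != inord 2. Proof. by rewrite -val_eqE /= inordK. Qed.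
Let ne12 : (inord 1 : 'I_3) != inord 2. Proof. by rewrite -val_eqE /= !inordK. Qed.

Lemma perm13E :
  [/\ perm13 ord0 = inord 2, perm13 (inord 1) = inord 1 & perm13 (inord 2) = ord0].
Proof. by rewrite /perm13 tpermL tpermR tpermD // eq_sym. Qed.

Lemma perm132E :
  [/\ perm132 ord0 = inord 2, perm132 (inord 1) = ord0 & perm132 (inord 2) = inord 1].
Proof.
rewrite /perm132 !permM tpermL tpermR [tperm (inord 1) _ ord0]tpermD 1?eq_sym //.
by rewrite tpermL tpermR tpermD // eq_sym.
Qed.

Variables (d : nat) (a b c : F).

Lemma Omod_0 : Omod d a b c ord0 = OX d a. Proof. by []. Qed.
Lemma Omod_1 : Omod d a b c (inord 1) = OY d a b c.
Proof. by rewrite /Omod (_ : val _ = 1%N) //= inordK. Qed.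
Lemma Omod_2 : Omod d a b c (inord 2) = OZ d a b c.
Proof. by rewrite /Omod (_ : val _ = 2%N) //= inordK. Qed.

Definition OmodE := (Omod_0, Omod_1, Omod_2).

Lemma aut_m1p1E : ((aut_m1p1 ord0 = -1 :> F) * (aut_m1p1 (inord 1) = 1 :> F)
  * (aut_m1p1 (inord 2) = -1 :> F))%type.
Proof. by rewrite /aut_m1p1 !inordK. Qed.

Lemma aut_p1m1E : ((aut_p1m1 ord0 = 1 :> F) * (aut_p1m1 (inord 1) = -1 :> F)
  * (aut_p1m1 (inord 2) = -1 :> F))%type.
Proof. by rewrite /aut_p1m1 !inordK. Qed.

Lemma twist_W1 :
  [/\ twist aut_m1p1 perm13 (Omod d a b c) ord0 = - OZ d a b c,
      twist aut_m1p1 perm13 (Omod d a b c) (inord 1) = OY d a b c &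
      twist aut_m1p1 perm13 (Omod d a b c) (inord 2) = - OX d a].
Proof.
by have [E0 E1 E2] := perm13E; rewrite /twist E0 E1 E2 !aut_m1p1E !OmodE !scaleN1r scale1r.
Qed.

Lemma twist_W2 :
  [/\ twist aut_p1m1 perm13 (Omod d a b c) ord0 = - OZ d a b c,
      twist aut_p1m1 perm13 (Omod d a b c) (inord 1) = - OY d a b c &
      twist aut_p1m1 perm13 (Omod d a b c) (inord 2) = OX d a].
Proof.
by have [E0 E1 E2] := perm13E; rewrite /twist E0 E1 E2 !aut_p1m1E !OmodE !scaleN1r scale1r.
Qed.

Lemma twist_W3 :
  [/\ twist aut_p1m1 perm132 (Omod d a b c) ord0 = - OZ d a b c,
      twist aut_p1m1 perm132 (Omod d a b c) (inord 1) = OX d a &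
      twist aut_p1m1 perm132 (Omod d a b c) (inord 2) = - OY d a b c].
Proof.
by have [E0 E1 E2] := perm132E; rewrite /twist E0 E1 E2 !aut_p1m1E !OmodE !scaleN1r scale1r.
Qed.

Lemma OZ_hom m (P : 'M[F]_(m, d.+1)) X Y Z :
  X *m Y + Y *m X = Z + (2 * a * b - c * d.+1%:R)%:M ->
  P *m OX d a = X *m P -> P *m OY d a b c = Y *m P -> P *m OZ d a b c = Z *m P.
Proof.
move=> XY PX PY; rewrite mulmxBr mulmxDr !mulmxA PX PY -!mulmxA PX PY !mulmxA.
by rewrite -mulmxDl XY mulmxDl mul_mx_scalar mul_scalar_mx addrK.
Qed.

End Twists.

(** * Eigenvectors of Y and homomorphisms between twisted modules *)

Section Eigenvalues.
Variable F : numFieldType.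
Variable d : nat.
Hypothesis even_d : ~~ odd d.

Lemma OY_eig0 (a b c x : F) (u : 'cV[F]_d.+1) :
  (forall i, (i <= d)%N -> Otheta d b i != x) -> OY d a b c *m u = x *: u -> u = 0.
Proof.
move=> sep Yu; apply: ccoord_eq => // i _.
rewrite [RHS]/ccoord /ecoord trmx0 mul0mx mxE.
suffices: forall k i, (d < k + i)%N -> ccoord u i = 0 by apply; exact: (leq_addr i d.+1).
elim=> [|k IHk] {}i lt; first exact: ccoord_out.
have [le_i_d|] := leqP i d; last exact: ccoord_out.
have := congr1 (fun v => ccoord v i) Yu; rewrite ccoord_OY ccoordZ (IHk i.+1) ?addnS //.
move=> /eqP; rewrite mulr0 addr0 -subr_eq0 -mulrBl mulf_eq0 subr_eq0.
by rewrite (negPf (sep i le_i_d)) => /eqP.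
Qed.

(** The last row of the upper triangular [A] is zero, so [A] is singular and a null vector exists
    without an explicit formula. *)
Lemma OY_last_eigenvector (a b c : F) :
  exists2 u : 'cV[F]_d.+1, u != 0 & OY d a b c *m u = Otheta d b d *: u.
Proof.
pose A := OY d a b c - (Otheta d b d)%:M.
have /det0P[v v0 vA] : \det A^T == 0.
  rewrite det_tr; apply/det0P; exists (delta_mx 0 ord_max).
    apply: contraTneq isT => /rowP/(_ ord_max); rewrite !mxE !eqxx.
    by move/eqP; rewrite oner_eq0.
  rewrite -rowE; apply/rowP => j; rewrite !mxE.
  case: (eqVneq ord_max j) => [<-|ne]; first by rewrite eqxx mulr1n subrr.
  have -> : (val (@ord_max d) == j) = false by rewrite -val_eqE in ne; exact: negPf.
  by rewrite mulr0n subr0 ltn_eqF.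
exists v^T; first by rewrite -(trmx0 F) (inj_eq trmx_inj).
apply/eqP; rewrite -subr_eq0 -mul_scalar_mx -mulmxBl.
by rewrite -[_ *m _]trmxK trmx_mul trmxK vA trmx0.
Qed.

Variable b : F.
Hypothesis b_sep : forall e, odd e -> (e <= d.+1)%N ->
  (2 * b + e%:R != 0) && (2 * b - e%:R != 0).

(** [1 - Otheta d b 0] is the value that the formula for [Otheta d b] would give at index -1. The
    two excluded eigenvalues are thus the neighbours -1 and d+1 of the spectrum, and this is why
    [b_sep] now extends to [d.+1]. *)
Lemma Otheta_first_sep i : (i <= d)%N -> Otheta d b i != 1 - Otheta d b 0.
Proof.
move=> le_i_d; rewrite -subr_eq0 /Otheta signr_odd2 /=; case: ifP => oi.
  have -> : -1 * (2 * b - d%:R + 2 * i%:R) / 2 - (1 - (1 * (2 * b - d%:R + 2 * 0)) / 2)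
    = - i.+1%:R :> F by rewrite -natr1; field.
  by rewrite oppr_eq0 pnatr_eq0.
have lt : (d.+1 - i <= d.+1)%N by rewrite leq_subr.
have o : odd (d.+1 - i) by rewrite oddB ?leqW //= even_d oi.
have /andP[_] := b_sep o lt; rewrite natrB ?leqW //; congr (_ != _).
by rewrite -natr1; field.
Qed.

Lemma Otheta_last_sep i : (i <= d)%N -> Otheta d b i != Otheta d b d.+1.
Proof.
move=> le_i_d; rewrite -subr_eq0 /Otheta !signr_odd2 /= even_d; case: ifP => oi.
  have -> : -1 * (2 * b - d%:R + 2 * i%:R) / 2 - (-1 * (2 * b - d%:R + 2 * d.+1%:R)) / 2
    = (d.+1 - i)%:R :> F by rewrite natrB ?leqW // -natr1; field.
  by rewrite pnatr_eq0 subn_eq0 -ltnNge ltnS.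
have o : odd i.+1 by rewrite /= oi.
have /andP[+ _] := b_sep o (le_i_d : (i.+1 <= d.+1)%N); congr (_ != _).
by rewrite -!natr1; field.
Qed.

Lemma Otheta_rev i : (i <= d)%N -> - Otheta d (- b) i = Otheta d b (d - i).
Proof.
move=> le_i_d; rewrite /Otheta !signr_odd2 oddB // (negPf even_d) /= natrB //.
by case: odd; field.
Qed.

Variables a c : F.

(** [- OZ], [OY], [- OX] of the target satisfy the relations with the scalars of (a,b,c), and [b] is
    unchanged, so v_0 goes to v_0. *)
Lemma O_swap13_hom : exists2 P : 'M[F]_d.+1, P != 0 &
  [/\ P *m OX d a = - OZ d (- c) b (- a) *m P,
      P *m OY d a b c = OY d (- c) b (- a) *m P &
      P *m OZ d a b c = - OX d (- c) *m P].
Proof.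
have R1 : - OZ d (- c) b (- a) *m OY d (- c) b (- a) + OY d (- c) b (- a) *m - OZ d (- c) b (- a)
   = - OX d (- c) + (2 * a * b - c * d.+1%:R)%:M.
  rewrite mulNmx mulmxN -opprD addrC OYZ_rel // opprD; congr (_ + _).
  by rewrite -raddfN /=; congr (_%:M); ring.
have R2 : - OX d (- c) *m - OZ d (- c) b (- a) + - OZ d (- c) b (- a) *m - OX d (- c)
   = OY d (- c) b (- a) + (2 * c * a - b * d.+1%:R)%:M.
  rewrite !mulNmx !mulmxN !opprK addrC OZX_rel //; congr (_ + _%:M); ring.
have R3 : OY d (- c) b (- a) *m - OX d (- c) + - OX d (- c) *m OY d (- c) b (- a)
   = - OZ d (- c) b (- a) + (2 * b * c - a * d.+1%:R)%:M.
  rewrite mulNmx mulmxN -opprD [in LHS]addrC /OZ opprB addrAC -raddfD /=.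
  by rewrite [X in X%:M](_ : _ = 0) ?raddf0 ?add0r //; ring.
case: (O_hom_simple even_d R1 R2 R3 (w0 := ebase F d 0)).
- by rewrite OY_ebase // Ophi_0 scale0r addr0.
- by move=> u; apply: OY_eig0; exact: Otheta_first_sep.
- by move=> u; apply: OY_eig0; exact: Otheta_last_sep.
move=> P [PX PY Pe]; exists P; last by split=> //; exact: OZ_hom PX PY.
apply: contraTneq isT => P0; move: Pe; rewrite P0 mul0mx => /esym/colP/(_ ord0).
by rewrite !mxE => /eqP; rewrite oner_eq0.
Qed.

(** Negating both [Y] and [b] reverses the order of the spectrum ([Otheta_rev]), so v_0 goes to the
    eigenvector belonging to the last diagonal entry. *)
Lemma O_last_hom (X Z : 'M[F]_d.+1) a' c' : let Y := - OY d a' (- b) c' in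
  X *m Y + Y *m X = Z + (2 * a * b - c * d.+1%:R)%:M ->
  Z *m X + X *m Z = Y + (2 * c * a - b * d.+1%:R)%:M ->
  Y *m Z + Z *m Y = X + (2 * b * c - a * d.+1%:R)%:M ->
  exists2 P : 'M[F]_d.+1, P != 0 &
  [/\ P *m OX d a = X *m P, P *m OY d a b c = Y *m P & P *m OZ d a b c = Z *m P].
Proof.
move=> Y R1 R2 R3; have [u u0 Yu] := OY_last_eigenvector a' (- b) c'.
have Y_eig0 x (v : 'cV[F]_d.+1) : (forall i, (i <= d)%N -> Otheta d b i != x) -> Y *m v = x *: v -> v = 0.
  move=> sep; rewrite mulNmx => /(canRL (@opprK _)); rewrite -scaleNr.
  apply: OY_eig0 => i le_i_d; rewrite -eqr_oppLR Otheta_rev //.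
  by apply: sep; rewrite leq_subr.
case: (O_hom_simple even_d R1 R2 R3 (w0 := u)).
- by rewrite mulNmx Yu -scaleNr Otheta_rev // subnn.
- by move=> v; apply: Y_eig0; exact: Otheta_first_sep.
- by move=> v; apply: Y_eig0; exact: Otheta_last_sep.
move=> P [PX PY Pe]; exists P; last by split=> //; exact: OZ_hom PX PY.
by apply: contraNneq u0 => P0; rewrite -Pe P0 mul0mx.
Qed.

Lemma O_swap13N_hom : exists2 P : 'M[F]_d.+1, P != 0 &
  [/\ P *m OX d a = OZ d (- c) (- b) a *m P,
      P *m OY d a b c = - OY d (- c) (- b) a *m P &
      P *m OZ d a b c = - OX d (- c) *m P].
Proof.
apply: O_last_hom.
- rewrite mulNmx mulmxN -opprD addrC OYZ_rel // opprD; congr (_ + _).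
  by rewrite -raddfN /=; congr (_%:M); ring.
- rewrite mulNmx mulmxN -opprD addrC OZX_rel // opprD; congr (_ + _).
  by rewrite -raddfN /=; congr (_%:M); ring.
rewrite !mulNmx !mulmxN !opprK [in LHS]addrC /OZ -addrA -raddfN -raddfD /=.
by rewrite [X in X%:M](_ : _ = 0) ?raddf0 ?addr0 //; ring.
Qed.

Lemma O_sign_hom : exists2 P : 'M[F]_d.+1, P != 0 &
  [/\ P *m OX d a = OX d a *m P,
      P *m OY d a b c = - OY d a (- b) (- c) *m P &
      P *m OZ d a b c = - OZ d a (- b) (- c) *m P].
Proof.
apply: O_last_hom.
- rewrite mulNmx mulmxN -opprD /OZ opprB addrAC -raddfD /=.
  by rewrite [X in X%:M](_ : _ = 0) ?raddf0 ?add0r //; ring.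
- rewrite mulNmx mulmxN -opprD OZX_rel // opprD; congr (_ + _).
  by rewrite -raddfN /=; congr (_%:M); ring.
rewrite !mulNmx !mulmxN !opprK OYZ_rel //; congr (_ + _%:M); ring.
Qed.

End Eigenvalues.

Section TwistedModules.
Variable F : numFieldType.
Variable d : nat.
Hypothesis even_d : ~~ odd d.
Variables a b c : F.
Hypothesis b_sep : forall e, odd e -> (e <= d.+1)%N ->
  (2 * b + e%:R != 0) && (2 * b - e%:R != 0).
Hypothesis phi_neq0 : forall i, (0 < i <= d)%N -> Ophi d a b c i != 0.
Hypothesis phi'_neq0 : forall i, (0 < i <= d)%N -> Ophi d a (- b) (- c) i != 0.

Lemma Omod_irr : mx_irr (Omod d a b c).
Proof.
move=> U U_inv; apply: (O_irr even_d _ phi_neq0 phi'_neq0).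
- by move=> e odd_e le_e_d; apply: b_sep; rewrite // leqW.
- by have := U_inv ord0; rewrite Omod_0.
- by have := U_inv (inord 1); rewrite Omod_1.
Qed.

Lemma twist_W1_irr : mx_irr (twist aut_m1p1 perm13 (Omod d a b c)).
Proof.
apply: mx_irr_twist Omod_irr; apply: ord3P;
by rewrite aut_m1p1E ?oppr_eq0 oner_eq0.
Qed.

Lemma twist_p1m1_irr sg : mx_irr (twist aut_p1m1 sg (Omod d a b c)).
Proof.
apply: mx_irr_twist Omod_irr; apply: ord3P;
by rewrite aut_p1m1E ?oppr_eq0 oner_eq0.
Qed.

Lemma twist_W1_iso :
  mx_iso (twist aut_m1p1 perm13 (Omod d a b c)) (Omod d (- c) b (- a)).
Proof.
have [P P0 [PX PY PZ]] := O_swap13_hom even_d b_sep a c.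
have [E0 E1 E2] := twist_W1 d a b c.
have PW j : P *m twist aut_m1p1 perm13 (Omod d a b c) j = Omod d (- c) b (- a) j *m P.
  move: j; apply: ord3P; rewrite ?E0 ?E1 ?E2 OmodE // mulmxN.
    by rewrite PZ mulNmx opprK.
  by rewrite PX mulNmx opprK.
by exists P => //; exact: iso_of_hom twist_W1_irr P0 PW.
Qed.

Lemma twist_W2_iso :
  mx_iso (twist aut_p1m1 perm13 (Omod d a b c)) (Omod d (- c) (- b) a).
Proof.
have [P P0 [PX PY PZ]] := O_swap13N_hom even_d b_sep a c.
have [E0 E1 E2] := twist_W2 d a b c.
have PW j : P *m twist aut_p1m1 perm13 (Omod d a b c) j = Omod d (- c) (- b) a j *m P.
  move: j; apply: ord3P; rewrite ?E0 ?E1 ?E2 OmodE // mulmxN.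
    by rewrite PZ mulNmx opprK.
  by rewrite PY mulNmx opprK.
by exists P => //; exact: iso_of_hom (@twist_p1m1_irr perm13) P0 PW.
Qed.

(** [O_sign_hom] changes the signs of [b] and [c] while keeping the generators in place;
    [O_rotation] then performs the 3-cycle. *)
Lemma twist_W3_iso :
  mx_iso (twist aut_p1m1 perm132 (Omod d a b c)) (Omod d (- c) a (- b)).
Proof.
have [P P0 [PX PY PZ]] := O_sign_hom even_d b_sep a c.
have [Q Q0 [QX QY]] := O_rotation even_d (- c) a (- b).
have QZ : Q *m OZ d a (- b) (- c) = OX d (- c) *m Q.
  by apply: OZ_hom QX QY; exact: OYZ_rel.
have irr := Omod_irr.
(* Invertibility of [P] ensures that the composite [Q *m P] is nonzero. *)
have uP : P \in unitmx.
  pose B : bimx F d.+1 := fun j => match val j with 0 => OX d a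
     | 1 => - OY d a (- b) (- c) | _ => - OZ d a (- b) (- c) end.
  apply: (@iso_of_hom _ _ _ B _ irr P0); apply: ord3P; rewrite OmodE /B //.
    by rewrite (_ : val _ = 1%N) //= inordK.
  by rewrite (_ : val _ = 2%N) //= inordK.
have [E0 E1 E2] := twist_W3 d a b c.
have PW j : (Q *m P) *m twist aut_p1m1 perm132 (Omod d a b c) j
    = Omod d (- c) a (- b) j *m (Q *m P).
  move: j; apply: ord3P; rewrite ?E0 ?E1 ?E2 OmodE ?mulmxN -mulmxA ?PX ?PY ?PZ.
  - by rewrite mulNmx mulmxN opprK !mulmxA QZ.
  - by rewrite !mulmxA QX.
  - by rewrite mulNmx mulmxN opprK !mulmxA QY.
exists (Q *m P) => //; apply: iso_of_hom (@twist_p1m1_irr perm132) _ PW.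
by apply: contraNneq Q0 => QP0; rewrite -(mulmxK uP Q) QP0 mul0mx.
Qed.

End TwistedModules.

(** * From coordinates to module isomorphisms *)

Section Coordinates.
Variables (F : numFieldType) (V : lmodType F) (d : nat).
Hypothesis even_d : ~~ odd d.
Variables a b c : F.
Variables (ops : 'I_3 -> V -> V) (S : pred V) (W : bimx F d.+1).
Variables (jL jR : 'I_3) (sL sR : F).
Hypothesis j3 : forall j, [\/ j = ord0, j = jL | j = jR].
(** In each of W_1, W_2, W_3 the generator [X] acts by [- OZ], and [Y], [Z] act by the two
    bidiagonal matrices with opposite signs. *)
Hypothesis sLR : sL * sR = -1.
Hypothesis W0 : W ord0 = - OZ d a b c.
Hypothesis WL : W jL = sL *: OX d a.
Hypothesis WR : W jR = sR *: OY d a b c.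
Hypothesis S_ops : forall j u, u \in S -> ops j u \in S.

(* [G e i] is the coordinate of index [i] in the copy [e] of the module, up to
   a factor that depends on [e] and [i]. *)
Variable G : bool -> nat -> V -> F.
Hypothesis G_linear : forall e i x u v, G e i (x *: u + v) = x * G e i u + G e i v.
Variables l r : bool -> nat -> F.
Hypothesis l_neq0 : forall e i, (i < d)%N -> l e i != 0.
Hypothesis lr : forall e i, (i < d)%N -> l e i * r e i = - Ophi d a b c i.+1.
Hypothesis GL0 : forall e u, u \in S ->
  G e 0 (ops jL u) = sL * Otheta d a 0 * G e 0 u.
Hypothesis GL : forall e i u, u \in S -> (i < d)%N ->
  G e i.+1 (ops jL u) = sL * Otheta d a i.+1 * G e i.+1 u + l e i * G e i u.
Hypothesis GR : forall e i u, u \in S -> (i < d)%N ->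
  G e i (ops jR u) = sR * Otheta d b i * G e i u + r e i * G e i.+1 u.
Hypothesis GRd : forall e u, u \in S ->
  G e d (ops jR u) = sR * Otheta d b d * G e d u.
Hypothesis GX : forall e i u, u \in S -> (i <= d)%N ->
  G e i (ops ord0 u) = G e i (ops jL (ops jR u)) + G e i (ops jR (ops jL u))
    + (2 * a * b - c * d.+1%:R) * G e i u.

(** Diagonal rescaling that turns every lower coefficient [l e i] into [sL]. The upper coefficients
    are then governed by the products [l e i * r e i], which explains the form of [lr]. *)
Let scale e i := \prod_(j < i) (sL / l e j).
Let half e (u : V) : 'cV[F]_d.+1 := \col_(i < d.+1) (scale e i * G e i u).
Let phi u := col_mx (half false u) (half true u).

Let scale_neq0 e i : (i <= d)%N -> scale e i != 0.
Proof.
move=> le_i_d; apply/prodf_neq0 => j _.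
rewrite mulf_neq0 ?invr_eq0 ?l_neq0 ?(leq_trans (ltn_ord j)) //.
by apply: contra_eq_neq sLR => ->; rewrite mul0r eq_sym oppr_eq0 oner_eq0.
Qed.

Let halfE e i u : (i <= d)%N -> ccoord (half e u) i = scale e i * G e i u.
Proof.
by move=> le_i_d; rewrite /ccoord /ecoord (mul_ebase _ (le_i_d : (i < d.+1)%N)) !mxE.
Qed.

Let halfL e u : u \in S -> half e (ops jL u) = W jL *m half e u.
Proof.
move=> uS; apply: ccoord_eq => // i le_i_d; rewrite WL -scalemxAl ccoordZ ccoord_OX //.
case: i le_i_d => [|i] lt_i_d; rewrite !halfE ?(ltnW lt_i_d) //.
  by rewrite GL0 // addr0; ring.
rewrite GL // /scale big_ord_recr /=; field.
by rewrite l_neq0.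
Qed.

Let halfR e u : u \in S -> half e (ops jR u) = W jR *m half e u.
Proof.
move=> uS; apply: ccoord_eq => // i; rewrite WR -scalemxAl ccoordZ ccoord_OY.
rewrite leq_eqVlt => /predU1P[->|lt_i_d].
  by rewrite Ophi_last // mul0r addr0 !halfE // GRd //; ring.
rewrite !halfE ?(ltnW lt_i_d) // GR // /scale big_ord_recr /=.
have -> : r e i = - Ophi d a b c i.+1 / l e i.
  by rewrite -(lr e lt_i_d) mulrC mulKf // l_neq0.
transitivity (\prod_(i0 < i) (sL / l e i0) * (sR * Otheta d b i * G e i u
    + (sL * sR) * Ophi d a b c i.+1 / l e i * G e i.+1 u)).
  by rewrite sLR; ring.
by field; rewrite l_neq0.
Qed.

Let half0 e u : u \in S -> half e (ops ord0 u) = W ord0 *m half e u.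
Proof.
move=> uS; transitivity (half e (ops jL (ops jR u)) + half e (ops jR (ops jL u))
    + (2 * a * b - c * d.+1%:R) *: half e u).
  apply/colP => i; have le_i_d : (i <= d)%N := ltn_ord i.
  by rewrite !mxE (GX e uS le_i_d) !mulrDr [in RHS]mulrCA.
rewrite !(halfL, halfR) ?S_ops // W0 WL WR /OZ opprB mulmxBl mul_scalar_mx.
rewrite mulmxDl -!scalemxAl -!scalemxAr !scalerA (mulrC sR) sLR !scaleN1r.
by rewrite opprD !mulmxA addrC.
Qed.

Lemma coordinates_iso :
  [/\ forall x u v, phi (x *: u + v) = x *: phi u + phi v,
      forall u, (phi u == 0) <-> (forall e i, (i <= d)%N -> G e i u = 0),
      (forall h : bool -> nat -> F, exists2 u, u \in S &
         forall e i, (i <= d)%N -> G e i u = h e i) ->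
        forall w, exists2 u, u \in S & phi u = w &
      forall j u, u \in S -> phi (ops j u) = dsum2 W j *m phi u].
Proof.
split.
- move=> x u v; rewrite scale_col_mx add_col_mx; congr col_mx;
    apply/colP => i; rewrite !mxE G_linear; ring.
- move=> u; split=> [/eqP phi0 e i le_i_d|G0].
    move: phi0; rewrite -[0]vsubmxK => /eq_col_mx[h0 h1].
    have : half e u = 0 by case: e; rewrite ?h0 ?h1 linear0.
    move=> /(congr1 (fun w => ccoord w i)); rewrite halfE // /ccoord /ecoord trmx0 mul0mx mxE.
    by move/eqP; rewrite mulf_eq0 (negPf (scale_neq0 e le_i_d)) => /eqP.
  rewrite -[0]vsubmxK !linear0; apply/eqP; congr col_mx;
  by apply/colP => i; rewrite !mxE G0 ?mulr0 // -ltnS.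
- move=> onto w; pose h e i := (scale e i)^-1 * ccoord (if e then dsubmx w else usubmx w) i.
  have [u uS Gu] := onto h; exists u => //; rewrite -[w]vsubmxK; congr col_mx;
  apply: ccoord_eq => // i le_i_d; by rewrite halfE // Gu // mulVKf // scale_neq0.
move=> j u uS; rewrite /dsum2 mul_block_col !mul0mx addr0 add0r.
by case: (j3 j) => ->; rewrite /phi ?half0 ?halfL ?halfR.
Qed.

Lemma coordinates_quot_iso (U : pred V) : submod ops S -> submod ops U -> {subset U <= S} ->
  (forall h : bool -> nat -> F, exists2 u, u \in S &
         forall e i, (i <= d)%N -> G e i u = h e i) ->
  (forall u, u \in S -> (u \in U) <-> (forall e i, (i <= d)%N -> G e i u = 0)) ->
  quot_iso ops S U (dsum2 W).
Proof.
move=> S_sub U_sub US onto ker; have [phi_lin phi_ker phi_onto phi_ops] := coordinates_iso.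
split=> //; exists phi; split=> //; last exact: phi_onto.
by move=> u uS; apply/idP/idP => [/phi_ker/ker|/ker/phi_ker]; apply.
Qed.

Lemma coordinates_iso_mx : submod ops S ->
  (forall h : bool -> nat -> F, exists2 u, u \in S &
         forall e i, (i <= d)%N -> G e i u = h e i) ->
  (forall u, u \in S -> (forall e i, (i <= d)%N -> G e i u = 0) -> u = 0) ->
  iso_mx ops S (dsum2 W).
Proof.
move=> S_sub onto ker; have [phi_lin phi_ker phi_onto phi_ops] := coordinates_iso.
split=> //; exists phi; split=> //; last exact: phi_onto.
have [_ S_lin _] := S_sub.
move=> u v uS vS Euv; apply/eqP; rewrite -subr_eq0 addrC -scaleN1r; apply/eqP.
apply: ker; first exact: S_lin.
by apply/phi_ker; rewrite phi_lin Euv scaleN1r addNr.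
Qed.

End Coordinates.

(** * The parameters of W_1 and W_2 *)

(* [dbr k_i j] is the scalar by which [T_i] maps [x_i^j] to [x_i^(j-1)]. *)
Definition dbr (F : pzRingType) (k : F) (j : nat) : F :=
  j%:R + (if odd j then 2 * k else 0).

Lemma even_pred t : odd t -> ~~ odd t.-1.
Proof. by case: t. Qed.

Section WindowParameters.
Variables (F : numFieldType) (k1 k2 k3 : F) (n t2 t3 : nat).
Hypothesis even_n : ~~ odd n.
Hypothesis odd_t2 : odd t2.
Hypothesis odd_t3 : odd t3.
Hypothesis k2E : 2 * k2 = - t2%:R.
Hypothesis k3E : 2 * k3 = - t3%:R.
Hypothesis le_t_n : (t2 + t3 <= n)%N.

(* On [Mn], [Y Z + Z Y = X + lamX]. *)
Definition lamX : F := 2 * k1 * (k1 + k2 + k3 + n.+1%:R) + 2 * k2 * k3.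

Let d := (n - t2 - t3)%N.
Let N : F := n.+1%:R / 2.
Let K : F := k1 + k2 + k3.

Let k2E' : k2 = - t2%:R / 2.
Proof. by rewrite -k2E mulrC mulKf // pnatr_eq0. Qed.
Let k3E' : k3 = - t3%:R / 2.
Proof. by rewrite -k3E mulrC mulKf // pnatr_eq0. Qed.

Lemma W1_even : ~~ odd d.
Proof. by move: even_n odd_t2 odd_t3 le_t_n; rewrite /d; lia. Qed.

Let nE : n%:R = d%:R + t2%:R + t3%:R :> F.
Proof. by rewrite -!natrD; congr _%:R; move: le_t_n; rewrite /d; lia. Qed.
Let t2E : t2%:R = t2.-1%:R + 1 :> F.
Proof. by rewrite natr1 prednK // odd_gt0. Qed.

(** The right side is the diagonal coefficient of [Z] at x_2-exponent t_2 + i found in [op_Z0];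
    [W1_thetas] is its analogue for [Y] at x_3-exponent n - t_2 - i, and [W1_phi] compares the
    off-diagonal products. *)
Lemma W1_theta i :
  - Otheta d (k1 + k3 + N) i = (-1) ^+ (t2 + i) * (dbr k2 (t2 + i) + 2^-1 + k1) + k2.
Proof.
rewrite /N /dbr /Otheta !signr_odd2 oddD odd_t2 natrD -(natr1 n) nE k3E' k2E'.
by case: (odd i) => /=; field.
Qed.

Lemma W1_thetas i : (i <= d)%N -> Otheta d (- k1 - k2 - N) i =
  (-1) ^+ (t2 + i) * (dbr k3 (n - t2 - i) + 2^-1 + k1) + k3.
Proof.
move=> le_i_d; have oz : odd (n - t2 - i) = ~~ odd i.
  by move: even_n odd_t2 odd_t3 le_t_n le_i_d; rewrite /d; lia.
have zE : (n - t2 - i)%:R = d%:R + t3%:R - i%:R :> F.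
  rewrite -natrD -natrB; last by rewrite (leq_trans le_i_d) ?leq_addr.
  by congr _%:R; move: le_t_n le_i_d; rewrite /d; lia.
rewrite /N /dbr oz zE /Otheta !signr_odd2 oddD odd_t2 -(natr1 n) nE k3E' k2E'.
by case: (odd i) => /=; field.
Qed.

Lemma W1_phi i : (i < d)%N -> Ophi d (k1 + k3 + N) (- k1 - k2 - N) (- N) i.+1 =
  dbr k2 (t2 + i).+1 * dbr k3 (n - t2 - i).
Proof.
move=> lt_i_d; have oz : odd (n - t2 - i) = ~~ odd i.
  by move: even_n odd_t2 odd_t3 le_t_n lt_i_d; rewrite /d; lia.
have zE : (n - t2 - i)%:R = d%:R + t3%:R - i%:R :> F.
  rewrite -natrD -natrB; last by rewrite (leq_trans (ltnW lt_i_d)) ?leq_addr.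
  by congr _%:R; move: le_t_n lt_i_d; rewrite /d; lia.
rewrite /N /dbr oz zE /Ophi /= oddD odd_t2 -!natr1 natrD nE k3E' k2E'.
by case: (odd i) => /=; field.
Qed.

Lemma W1_kappa :
  2 * (k1 + k3 + N) * (- k1 - k2 - N) - (- N) * d.+1%:R = - lamX.
Proof. by rewrite /lamX /N -!natr1 nE k3E' k2E'; field. Qed.

(** The window of W_2 starts at x_2-exponent 0. With the indices 2 and 3 exchanged, these identities
    also serve W_3. *)
Lemma W2_theta i : Otheta t2.-1 k1 i = (-1) ^+ i * (dbr k2 i + 2^-1 + k1) + k2.
Proof.
rewrite /dbr /Otheta !signr_odd2 k2E' t2E.
by case: (odd i) => /=; field.
Qed.

Lemma W2_thetas i : (i <= t2.-1)%N -> - Otheta t2.-1 (- K - n.+1%:R) i =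
  (-1) ^+ i * (dbr k3 (n - i) + 2^-1 + k1) + k3.
Proof.
move=> le_i_t2; have oz : odd (n - i) = odd i.
  by move: even_n odd_t2 odd_t3 le_t_n le_i_t2; lia.
have zE : (n - i)%:R = n%:R - i%:R :> F.
  by rewrite natrB //; move: le_t_n le_i_t2; lia.
rewrite /K /dbr oz zE /Otheta !signr_odd2 -(natr1 n) k3E' k2E' t2E.
by case: (odd i) => /=; field.
Qed.

Lemma W2_phi i : (i < t2.-1)%N -> Ophi t2.-1 k1 (- K - n.+1%:R) (- k3) i.+1 =
  dbr k2 i.+1 * dbr k3 (n - i).
Proof.
move=> lt_i_t2; have oz : odd (n - i) = odd i.
  by move: even_n odd_t2 odd_t3 le_t_n lt_i_t2; lia.
have zE : (n - i)%:R = n%:R - i%:R :> F.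
  by rewrite natrB //; move: le_t_n lt_i_t2; lia.
rewrite /K /dbr oz zE /Ophi /= -!natr1 k3E' k2E' t2E.
by case: (odd i) => /=; field.
Qed.

Lemma W2_kappa :
  2 * k1 * (- K - n.+1%:R) - (- k3) * (t2.-1).+1%:R = - lamX.
Proof.
by rewrite /lamX /K prednK ?odd_gt0 // -!natr1 k3E' k2E'; field.
Qed.

Lemma dbr2_t2 : dbr k2 t2 = 0.
Proof. by rewrite /dbr odd_t2 k2E subrr. Qed.

Lemma dbr2_neq0 j : (0 < j)%N -> (j != t2)%N -> dbr k2 j != 0.
Proof.
move=> j_gt0 ne; rewrite /dbr k2E; case: (odd j); last by rewrite addr0 pnatr_eq0 -lt0n.
by rewrite subr_eq0 eqr_nat.
Qed.

Hypothesis k1_ge0 : 0 <= k1.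

Let sep_of_lt (x : F) D : (D.+1%:R < 2 * x \/ 2 * x < - D.+1%:R) ->
  forall e, odd e -> (e <= D.+1)%N -> (2 * x + e%:R != 0) && (2 * x - e%:R != 0).
Proof.
move=> lt e _ le; have le_e : e%:R <= D.+1%:R :> F by rewrite ler_nat.
have e0 : 0 <= e%:R :> F by rewrite ler0n.
case: lt => lt.
  have lt1 := le_lt_trans le_e lt.
  by rewrite !lt0r_neq0 ?subr_gt0 // ltr_wpDr // (le_lt_trans e0).
have lt1 : 2 * x < - e%:R by rewrite (lt_le_trans lt) // lerN2.
apply/andP; split; rewrite ltr0_neq0 //; first by rewrite -ltrBrDr sub0r.
by rewrite subr_lt0 (lt_le_trans lt1) // (le_trans _ e0) // oppr_le0.
Qed.

Lemma W1_sep e : odd e -> (e <= d.+1)%N ->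
  (2 * (- k1 - k2 - N) + e%:R != 0) && (2 * (- k1 - k2 - N) - e%:R != 0).
Proof.
apply: sep_of_lt; right; rewrite -subr_lt0.
have -> : 2 * (- k1 - k2 - N) - - d.+1%:R = - (2 * k1 + t3%:R).
  by rewrite /N -!natr1 nE k2E'; field.
by rewrite oppr_lt0 ltr_wpDl ?mulr_ge0 // ltr0n odd_gt0.
Qed.

Lemma W2_sep e : odd e -> (e <= t2.-1.+1)%N ->
  (2 * (- K - n.+1%:R) + e%:R != 0) && (2 * (- K - n.+1%:R) - e%:R != 0).
Proof.
apply: sep_of_lt; right; rewrite -subr_lt0.
have -> : 2 * (- K - n.+1%:R) - - t2.-1.+1%:R = - (2 * k1 + (d + d + t3).+2%:R).
  by rewrite prednK ?odd_gt0 // /K -!natr1 !natrD nE k3E' k2E'; field.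
by rewrite oppr_lt0 ltr_wpDl ?mulr_ge0 // ltr0n.
Qed.

(** By [W1_phi] this is a product of two values of [dbr], whose only positive zeros are t_2 and t_3;
    inside the window both arguments lie strictly above them. *)
Lemma W1_phi_neq0 i : (0 < i <= d)%N ->
  Ophi d (k1 + k3 + N) (- k1 - k2 - N) (- N) i != 0.
Proof.
case: i => // i /= lt_i_d; rewrite W1_phi // mulf_neq0 ?dbr2_neq0 //.
  by rewrite -addnS -{2}[t2]addn0 eqn_add2l.
rewrite /dbr k3E; case: ifP => _; last by rewrite addr0 pnatr_eq0; move: lt_i_d; rewrite /d; lia.
by rewrite subr_eq0 eqr_nat; move: lt_i_d; rewrite /d; lia.
Qed.

Let neq0_of_gt0 (x y : F) : y = - x -> 0 < x -> y != 0.
Proof. by move=> -> x0; rewrite oppr_eq0 lt0r_neq0. Qed.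

(** The linear factor equals -(4 k_1 + a positive integer), hence is nonzero for k_1 >= 0. *)
Lemma W1_phi'_neq0 i : (0 < i <= d)%N ->
  Ophi d (k1 + k3 + N) (- (- k1 - k2 - N)) (- - N) i != 0.
Proof.
move=> /andP[i_gt0 le_i_d]; rewrite /Ophi; case: ifP => _; rewrite !mulf_neq0 ?invr_eq0 ?pnatr_eq0 -?lt0n //.
- apply: (@neq0_of_gt0 (4 * k1 + (n + n + i + i).+2%:R)).
    by rewrite /N -!natr1 !natrD nE k3E' k2E'; field.
  by rewrite ltr_wpDl ?mulr_ge0 // ltr0n.
- by rewrite subr_eq0 eqr_nat neq_ltn ltnS le_i_d.
apply: (@neq0_of_gt0 (4 * k1 + (i + i)%:R)).
  by rewrite /N -!natr1 !natrD nE k3E' k2E'; field.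
by rewrite ltr_wpDl ?mulr_ge0 // ltr0n addn_gt0 i_gt0.
Qed.

Lemma W2_phi_neq0 i : (0 < i <= t2.-1)%N -> Ophi t2.-1 k1 (- K - n.+1%:R) (- k3) i != 0.
Proof.
case: i => // i /= lt_i_t2; rewrite W2_phi // mulf_neq0 ?dbr2_neq0 //.
  by move: lt_i_t2; lia.
rewrite /dbr k3E; case: ifP => _.
  by rewrite subr_eq0 eqr_nat; move: le_t_n lt_i_t2; lia.
by rewrite addr0 pnatr_eq0; move: le_t_n lt_i_t2; lia.
Qed.

Lemma W2_phi'_neq0 i : (0 < i <= t2.-1)%N ->
  Ophi t2.-1 k1 (- (- K - n.+1%:R)) (- - k3) i != 0.
Proof.
move=> /andP[i_gt0 le_i_t]; rewrite /Ophi; case: ifP => _; rewrite !mulf_neq0 ?invr_eq0 ?pnatr_eq0 -?lt0n //.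
- apply: (@neq0_of_gt0 (4 * k1 + (d + d + i + i).+2%:R)).
    by rewrite prednK ?odd_gt0 // /K -!natr1 !natrD nE k3E' k2E'; field.
  by rewrite ltr_wpDl ?mulr_ge0 // ltr0n.
- by rewrite subr_eq0 eqr_nat neq_ltn ltnS le_i_t.
apply: (@neq0_of_gt0 (4 * k1 + (d + d + t3 + t3 + i + i).+2%:R)).
  by rewrite prednK ?odd_gt0 // /K -!natr1 !natrD nE k3E' k2E'; field.
by rewrite ltr_wpDl ?mulr_ge0 // ltr0n.
Qed.

End WindowParameters.

(** * The Dirac operator on coefficients *)

Section Coefficients.
Variable R : realType.
Local Notation C := (R[i]).
Local Notation Pol := {mpoly C[3]}.
Implicit Types (p : Pol) (i : 'I_3) (m : 'X_{1..3}).

Lemma mcoeff_refl i p m : (reflp i p)@_m = (-1) ^+ m i * p@_m.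
Proof.
have reflX m' : reflp i ('X_[m'] : Pol) = (-1) ^+ m' i *: 'X_[m'].
  rewrite /reflp comp_mpolyX (bigD1 i) //= tnth_mktuple eqxx.
  have -> : (- 'X_i : Pol) ^+ m' i = (-1) ^+ m' i *: 'X_i ^+ m' i.
    elim: (m' i) => [|e IHe]; first by rewrite !expr0 scale1r.
    by rewrite !exprS IHe mulN1r scaleNr mulNr -scalerAr.
  rewrite -scalerAl; congr (_ *: _).
  rewrite [RHS]mpolyXE_id [RHS](bigD1 i) //=; congr (_ * _); apply: eq_bigr => j ne.
  by rewrite tnth_mktuple (negPf ne).
rewrite [reflp i p]comp_mpolyEX raddf_sum /=.
rewrite [X in _ = _ * X@__]mpolyE raddf_sum /= mulr_sumr; apply: eq_bigr => m' _.
rewrite -/(reflp i _) reflX !mcoeffZ mcoeffX.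
by case: eqP => [->|]; rewrite ?mulr0 // !mulr1 mulrC.
Qed.

(** Monomials free of x_i must be absent: the truncated subtraction in [divX] would leave them in
    place. *)
Lemma mcoeff_divX i p m : (forall m', m' i = 0%N -> p@_m' = 0) ->
  (divX i p)@_m = p@_(m + U_(i)).
Proof.
move=> p0; rewrite /divX raddf_sum /= [X in _ = X@__]mpolyE raddf_sum /=.
apply: eq_big_seq => m' m'_in; rewrite !mcoeffZ !mcoeffX; congr (_ * _%:R).
have m'i : (0 < m' i)%N.
  rewrite lt0n; apply: contraTneq m'_in => /p0 E.
  by rewrite mcoeff_msupp E eqxx.
congr nat_of_bool; rewrite -[LHS](inj_eq (@addIm _ U_(i)%MM)) submK //.
by apply/mnm_lepP => j; rewrite mnm1E; case: eqP => [<-|].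
Qed.

Lemma mcoeff_dunkl k i p m :
  (dunkl k i p)@_m = dbr (rC (k i)) (m i).+1 * p@_(m + U_(i)).
Proof.
rewrite /dunkl mcoeffD mcoeffZ mcoeff_deriv mcoeff_divX; last first.
  by move=> m' m'i; rewrite mcoeffB mcoeff_refl m'i expr0 mul1r subrr.
rewrite mcoeffB mcoeff_refl mnmDE mnm1E eqxx addn1 /dbr -mulr_natl signr_odd2 /=.
by case: odd => /=; ring.
Qed.

Lemma mcoeff_mulXi i p m :
  ('X_i * p)@_m = if m i == 0%N then 0 else p@_(m - U_(i)).
Proof.
rewrite mulrC; case: eqP => [mi0|/eqP mi].
  apply/eqP; rewrite mcoeff_eq0 (perm_mem (msuppMX _ _)).
  apply/mapP => -[m' _ E]; move: mi0; rewrite E mnmDE mnm1E eqxx.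
  by [].
have le_Ui_m : (U_(i) <= m)%MM.
  by apply/mnm_lepP => j; rewrite mnm1E; case: eqP => [<-|]; rewrite // lt0n.
by rewrite -(mcoeffMX p U_(i) (m - U_(i))) addmC submK.
Qed.

Definition mon (x y z : nat) : 'X_{1..3} := [multinom nth 0%N [:: x; y; z] i | i < 3].

Lemma monE m : m = mon (m ord0) (m (inord 1)) (m (inord 2)).
Proof.
apply/mnmP; apply: ord3P; by rewrite mnmE ?inordK.
Qed.

End Coefficients.

(** * D, X, Y, Z as recurrences on coefficient arrays *)

Section CoefficientOperators.
Variable F : fieldType.
Variables k1 k2 k3 I : F.
Hypothesis I2 : I * I = -1.
Implicit Types (b : bool) (P Q : nat -> nat -> nat -> F) (g : bool -> nat -> nat -> nat -> F).

(* The components of a pair [(P, Q)] on the two eigenspaces of [e_1], with the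
   weight [I ^+ y] chosen so that no imaginary unit is left in [op_X, op_Y, op_Z]. *)
Definition split_comp P Q b x y z : F :=
  I ^+ y * (P x y z + (-1) ^+ b * Q x y z).

Definition co_T1 P x y z := dbr k1 x.+1 * P x.+1 y z.
Definition co_T2 P x y z := dbr k2 y.+1 * P x y.+1 z.
Definition co_T3 P x y z := dbr k3 z.+1 * P x y z.+1.
Definition co_x1 P x y z : F := if x is x'.+1 then P x' y z else 0.
Definition co_x2 P x y z : F := if y is y'.+1 then P x y' z else 0.
Definition co_x3 P x y z : F := if z is z'.+1 then P x y z' else 0.
Definition co_R1 P x y z := (-1) ^+ x * P x y z.
Definition co_R2 P x y z := (-1) ^+ y * P x y z.
Definition co_R3 P x y z := (-1) ^+ z * P x y z.

(** The steps in x_2 and x_3 flip [b] because [e_2] and [e_3] anticommute with [e_1]. The sign of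
    [e_1] is split off into [op_D]; it does not affect the kernel. *)
Definition dirac_row g b x y z : F :=
  dbr k1 x.+1 * g b x.+1 y z + dbr k2 y.+1 * g (~~ b) x y.+1 z
  + (-1) ^+ b * dbr k3 z.+1 * g (~~ b) x y z.+1.

Definition op_D g b x y z : F := (-1) ^+ b * dirac_row g b x y z.

Definition op_X g b x y z : F :=
  (-1) ^+ b * (-1) ^+ (y + z) *
    ((if z is z'.+1 then dbr k2 y.+1 * g b x y.+1 z' else 0)
     + (if y is y'.+1 then dbr k3 z.+1 * g b x y' z.+1 else 0))
  + (2^-1 * (-1) ^+ (y + z) + k2 * (-1) ^+ z + k3 * (-1) ^+ y) * g b x y z.

Definition op_Y g b x y z : F :=
  (-1) ^+ b * (-1) ^+ (x + z) *
    ((if z is z'.+1 then dbr k1 x.+1 * g (~~ b) x.+1 y z' else 0)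
     - (if x is x'.+1 then dbr k3 z.+1 * g (~~ b) x' y z.+1 else 0))
  + (2^-1 * (-1) ^+ (x + z) + k3 * (-1) ^+ x + k1 * (-1) ^+ z) * g b x y z.

Definition op_Z g b x y z : F :=
  - (-1) ^+ (x + y) *
    ((if y is y'.+1 then dbr k1 x.+1 * g (~~ b) x.+1 y' z else 0)
     + (if x is x'.+1 then dbr k2 y.+1 * g (~~ b) x' y.+1 z else 0))
  + (2^-1 * (-1) ^+ (x + y) + k1 * (-1) ^+ y + k2 * (-1) ^+ x) * g b x y z.

(** Restores a missing I^2 in terms whose weight I^y lags two powers behind, so that [ring] can
    compare both sides without knowing I^2 = -1. *)
Let sqI t : t = - (I * I * t).
Proof. by rewrite I2 mulN1r opprK. Qed.

Ltac signs := rewrite ?(exprD (-1 : F)) ?(exprS (-1 : F)) ?expr0 /= ?expr0 ?expr1 ?exprS.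

Lemma split_comp_D P Q b x y z :
  split_comp
    (fun x y z => co_T1 Q x y z - I * co_T2 Q x y z + co_T3 P x y z)
    (fun x y z => co_T1 P x y z + I * co_T2 P x y z - co_T3 Q x y z) b x y z =
  op_D (split_comp P Q) b x y z.
Proof.
rewrite /op_D /dirac_row /split_comp /co_T1 /co_T2 /co_T3.
by case: b; signs; ring.
Qed.

Lemma split_comp_X P Q b x y z :
  let L P := fun x y z => co_x3 (co_T2 P) x y z - co_x2 (co_T3 P) x y z in
  split_comp
    (fun x y z => I * L (co_R2 (co_R3 Q)) x y z + 2^-1 * co_R2 (co_R3 P) x y z
       + k2 * co_R3 P x y z + k3 * co_R2 P x y z)
    (fun x y z => I * L (co_R2 (co_R3 P)) x y z + 2^-1 * co_R2 (co_R3 Q) x y z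
       + k2 * co_R3 Q x y z + k3 * co_R2 Q x y z) b x y z =
  op_X (split_comp P Q) b x y z.
Proof.
rewrite /op_X /= /co_x2 /co_x3; case: y => [|y]; case: z => [|z].
- by rewrite /split_comp /co_T2 /co_T3 /co_R2 /co_R3; case: b; signs; ring.
- by rewrite /split_comp /co_T2 /co_T3 /co_R2 /co_R3; case: b; signs; ring.
- rewrite [split_comp P Q b x y 1]sqI.
  by rewrite /split_comp /co_T2 /co_T3 /co_R2 /co_R3; case: b; signs; ring.
rewrite [split_comp P Q b x y z.+2]sqI.
by rewrite /split_comp /co_T2 /co_T3 /co_R2 /co_R3; case: b; signs; ring.
Qed.

Lemma split_comp_Y P Q b x y z :
  let L P := fun x y z => co_x1 (co_T3 P) x y z - co_x3 (co_T1 P) x y z in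
  split_comp
    (fun x y z => I * - (I * L (co_R1 (co_R3 Q)) x y z) + 2^-1 * co_R1 (co_R3 P) x y z
       + k3 * co_R1 P x y z + k1 * co_R3 P x y z)
    (fun x y z => I * (I * L (co_R1 (co_R3 P)) x y z) + 2^-1 * co_R1 (co_R3 Q) x y z
       + k3 * co_R1 Q x y z + k1 * co_R3 Q x y z) b x y z =
  op_Y (split_comp P Q) b x y z.
Proof.
rewrite /op_Y /= /split_comp !mulrN !(mulrA I I) I2 /co_x1 /co_x3.
case: x => [|x]; case: z => [|z];
by rewrite /co_T1 /co_T3 /co_R1 /co_R3; case: b; signs; ring.
Qed.

Lemma split_comp_Z P Q b x y z :
  let L P := fun x y z => co_x2 (co_T1 P) x y z - co_x1 (co_T2 P) x y z in
  split_comp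
    (fun x y z => I * L (co_R1 (co_R2 P)) x y z + 2^-1 * co_R1 (co_R2 P) x y z
       + k1 * co_R2 P x y z + k2 * co_R1 P x y z)
    (fun x y z => I * - L (co_R1 (co_R2 Q)) x y z + 2^-1 * co_R1 (co_R2 Q) x y z
       + k1 * co_R2 Q x y z + k2 * co_R1 Q x y z) b x y z =
  op_Z (split_comp P Q) b x y z.
Proof.
rewrite /op_Z /= /co_x1 /co_x2.
case: y => [|y]; case: x => [|x].
- by rewrite /split_comp /co_T1 /co_T2 /co_R1 /co_R2; case: b; signs; ring.
- by rewrite /split_comp /co_T1 /co_T2 /co_R1 /co_R2; case: b; signs; ring.
- rewrite [split_comp P Q (~~ b) 1 y z]sqI.
  by rewrite /split_comp /co_T1 /co_T2 /co_R1 /co_R2; case: b; signs; ring.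
rewrite [split_comp P Q (~~ b) x.+2 y z]sqI.
by rewrite /split_comp /co_T1 /co_T2 /co_R1 /co_R2; case: b; signs; ring.
Qed.

Hypothesis F2 : (2 : F) != 0.

Ltac commute b :=
  rewrite /op_D /op_X /op_Y /op_Z /dirac_row /dbr /= ?negbK ?addSn ?addnS ?add0n ?addn0;
  case: b => /=; rewrite ?signr_odd2 /= ?oddD /=;
  repeat (match goal with |- context [odd ?i] => case: (odd i) end) => /=;
  rewrite -?natr1; field; exact: F2.

(** This commutation and the next two make the kernel of the Dirac operator stable under BI. *)
Lemma op_DX g b x y z : op_D (op_X g) b x y z = op_X (op_D g) b x y z.
Proof. by case: y => [|y]; case: z => [|z]; commute b. Qed.

Lemma op_DY g b x y z : op_D (op_Y g) b x y z = op_Y (op_D g) b x y z.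
Proof. by case: x => [|x]; case: z => [|z]; commute b. Qed.

Lemma op_DZ g b x y z : op_D (op_Z g) b x y z = op_Z (op_D g) b x y z.
Proof. by case: x => [|x]; case: y => [|y]; commute b. Qed.


Section Kernel.
Variable g : bool -> nat -> nat -> nat -> F.
Hypothesis g_ker : forall b x y z, dirac_row g b x y z = 0.

(** In [op_Y] and [op_Z] at x = 0, the other component enters only through its coefficient at x = 1.
    This identity expresses it by component [b] at x = 0, so the two components decouple. *)
Lemma dirac_row0 b y z : dbr k1 1 * g (~~ b) 1 y z =
  - (dbr k2 y.+1 * g b 0 y.+1 z) + (-1) ^+ b * dbr k3 z.+1 * g b 0 y z.+1.
Proof.
apply/eqP; rewrite -subr_eq0 -[X in _ == X](g_ker (~~ b) 0 y z) /dirac_row negbK.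
by apply/eqP; case: b => /=; rewrite ?expr0 ?expr1; ring.
Qed.

Lemma op_Y0 b y z : op_Y g b 0 y z =
  ((-1) ^+ z * (dbr k3 z + 2^-1 + k1) + k3) * g b 0 y z
  - (if z is z'.+1 then (-1) ^+ b * (-1) ^+ z * dbr k2 y.+1 * g b 0 y.+1 z' else 0).
Proof.
rewrite /op_Y add0n; case: z => [|z]; last rewrite dirac_row0.
  by rewrite /dbr /= expr0; ring.
by case: b => /=; rewrite ?expr0 ?expr1; ring.
Qed.

Lemma op_Z0 b y z : op_Z g b 0 y z =
  ((-1) ^+ y * (dbr k2 y + 2^-1 + k1) + k2) * g b 0 y z
  - (if y is y'.+1 then (-1) ^+ b * (-1) ^+ y * dbr k3 z.+1 * g b 0 y' z.+1 else 0).
Proof.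
rewrite /op_Z add0n; case: y => [|y]; last rewrite dirac_row0.
  by rewrite /dbr /= expr0; ring.
by case: b => /=; rewrite ?expr0 ?expr1; ring.
Qed.

(** Induction on [x]: the Dirac equation expresses the coefficient at x+1 by those at (y+1, z) and
    (y, z+1), which either lie in [A] again or carry a zero factor. *)
Lemma support_ker n (A : nat -> nat -> bool) :
  (forall x, (0 < x <= n)%N -> dbr k1 x != 0) ->
  (forall b x y z, (x + y + z)%N != n -> g b x y z = 0) ->
  (forall y z, A y z -> dbr k2 y.+1 = 0 \/ A y.+1 z) ->
  (forall y z, A y z -> dbr k3 z.+1 = 0 \/ A y z.+1) ->
  (forall b y z, A y z -> g b 0 y z = 0) ->
  forall b x y z, A y z -> g b x y z = 0.
Proof.
move=> k1_neq0 g_hom A2 A3 g0 b x; elim: x b => [|x IHx] b y z Ayz; first exact: g0.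
have [Exyz|] := eqVneq (x.+1 + y + z)%N n; last exact: g_hom.
have x_in : (0 < x.+1 <= n)%N by rewrite -Exyz -addnA leq_addr.
apply: (mulfI (k1_neq0 _ x_in)); rewrite mulr0 -[RHS](g_ker b x y z) /dirac_row.
have -> : dbr k2 y.+1 * g (~~ b) x y.+1 z = 0.
  by case: (A2 _ _ Ayz) => [->|/IHx ->]; rewrite ?mul0r ?mulr0.
have -> : (-1) ^+ b * dbr k3 z.+1 * g (~~ b) x y z.+1 = 0.
  by case: (A3 _ _ Ayz) => [->|/IHx ->]; rewrite ?(mulr0, mul0r).
by rewrite !addr0.
Qed.

End Kernel.

(** The subtracted scalar is [lamX] in degree n = y + z. As [op_Y g] and [op_Z g] lie in the kernel
    again, the bidiagonal formulas can be iterated and the claim becomes a finite check on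
    parities. *)
Lemma op_X0 g b y z : (forall b x y z, dirac_row g b x y z = 0) -> ~~ odd (y + z) ->
  op_X g b 0 y z = op_Y (op_Z g) b 0 y z + op_Z (op_Y g) b 0 y z
   - (2 * k1 * (k1 + k2 + k3 + (y + z).+1%:R) + 2 * k2 * k3) * g b 0 y z.
Proof.
move=> g_ker; rewrite oddD => even_yz.
have ker_op (op : (bool -> nat -> nat -> nat -> F) -> (bool -> nat -> nat -> nat -> F)) :
    (forall g b x y z, op_D (op g) b x y z = op (op_D g) b x y z) ->
    (forall b x y z, op (op_D g) b x y z = 0) ->
    forall b x y z, dirac_row (op g) b x y z = 0.
  move=> opD op0 b' x' y' z'; apply/eqP; have := opD g b' x' y' z'.
  by rewrite op0 /op_D => /eqP; rewrite mulf_eq0 signr_eq0.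
have D0 b' x' y' z' : op_D g b' x' y' z' = 0 by rewrite /op_D g_ker mulr0.
have kerY : forall b x y z, dirac_row (op_Y g) b x y z = 0.
  apply: ker_op op_DY _ => b' [|x] y' [|z']; rewrite /op_Y !D0; ring.
have kerZ : forall b x y z, dirac_row (op_Z g) b x y z = 0.
  apply: ker_op op_DZ _ => b' [|x] [|y'] z'; rewrite /op_Z !D0; ring.
rewrite (op_Y0 kerZ) (op_Z0 kerY).
case: y even_yz => [|y]; case: z => [|z] even_yz;
  rewrite ?(op_Y0 g_ker) ?(op_Z0 g_ker) /op_X /dbr ?negbK ?add0n ?addn0 -?natr1 ?natrD -?natr1;
  move: even_yz; rewrite ?signr_odd2 /= ?oddD /=;
  repeat (match goal with |- context [odd (nat_of_bool b)] => case: b => /= end);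
  repeat (match goal with |- context [odd ?i] => case: (odd i) end);
  move=> //= _; field; exact: F2.
Qed.

End CoefficientOperators.

Section CauchyKovalevskaya.
Variables (F : fieldType) (k1 k2 k3 I : F).
Fixpoint ck_ext (g0 : bool -> nat -> nat -> F) x (b : bool) y z : F :=
  if x is x'.+1 then
    - (dbr k2 y.+1 * ck_ext g0 x' (~~ b) y.+1 z
       + (-1) ^+ b * dbr k3 z.+1 * ck_ext g0 x' (~~ b) y z.+1) / dbr k1 x
  else g0 b y z.

(* The kernel of the Dirac operator is parametrized by the restriction to
   [x_1 = 0], because [T_1] is invertible in the degrees that occur. *)
Lemma ck_exists n (g0 : bool -> nat -> nat -> F) :
  (forall x, (0 < x <= n)%N -> dbr k1 x != 0) ->
  exists g : bool -> nat -> nat -> nat -> F,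
  [/\ forall b x y z, (x + y + z)%N != n -> g b x y z = 0,
      forall b x y z, dirac_row k1 k2 k3 g b x y z = 0 &
      forall b y z, (y + z)%N = n -> g b 0 y z = g0 b y z].
Proof.
(* All three terms of a Dirac row have the same degree, so truncation to degree [n] either keeps the
   whole row or annihilates it. *)
move=> k1_neq0; exists (fun b x y z => if (x + y + z == n)%N then ck_ext g0 x b y z else 0).
split=> [b x y z /negPf -> //|b x y z|b y z]; last by rewrite add0n => ->; rewrite eqxx.
rewrite /dirac_row !addSn !addnS !addSn.
have [E|_] := eqVneq (x + y + z).+1 n; last by rewrite !mulr0 !addr0.
have nz : dbr k1 x.+1 != 0 by apply: k1_neq0; move: E; lia.
by rewrite /=; field.
Qed.

Hypothesis I_neq0 : I != 0.
Hypothesis F2 : (2 : F) != 0.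

(** The two support clauses guarantee that the inverse of the splitting yields arrays of
    polynomials, not of power series. *)
Lemma split_comp_onto (g : bool -> nat -> nat -> nat -> F) :
  exists P Q, [/\ forall b x y z, split_comp I P Q b x y z = g b x y z,
    forall x y z, (forall b, g b x y z = 0) -> P x y z = 0 &
    forall x y z, (forall b, g b x y z = 0) -> Q x y z = 0].
Proof.
exists (fun x y z => (g false x y z + g true x y z) / (2 * I ^+ y)),
       (fun x y z => (g false x y z - g true x y z) / (2 * I ^+ y)).
split=> [b x y z|x y z g0|x y z g0]; last 2 first.
- by rewrite !g0 addr0 mul0r.
- by rewrite !g0 subrr mul0r.
have nz : I ^+ y != 0 by rewrite expf_neq0.
by rewrite /split_comp; case: b; rewrite /= ?expr0 ?expr1; field; rewrite nz F2.
Qed.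

Lemma split_comp_linear a (P Q P' Q' : nat -> nat -> nat -> F) b x y z :
  split_comp I (fun x y z => a * P x y z + P' x y z) (fun x y z => a * Q x y z + Q' x y z) b x y z
  = a * split_comp I P Q b x y z + split_comp I P' Q' b x y z.
Proof. by rewrite /split_comp; ring. Qed.

Lemma dirac_row_linear a (g g' : bool -> nat -> nat -> nat -> F) b x y z :
  dirac_row k1 k2 k3 (fun b x y z => a * g b x y z + g' b x y z) b x y z =
  a * dirac_row k1 k2 k3 g b x y z + dirac_row k1 k2 k3 g' b x y z.
Proof. by rewrite /dirac_row; ring. Qed.

Lemma split_comp_eq0 (P Q : nat -> nat -> nat -> F) x y z :
  (forall b, split_comp I P Q b x y z = 0) <-> P x y z = 0 /\ Q x y z = 0.
Proof.
split=> [g0|[P0 Q0] b]; last by rewrite /split_comp P0 Q0 mulr0 addr0 mulr0.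
have nz : I ^+ y != 0 by rewrite expf_neq0.
have E (b : bool) : P x y z + (-1) ^+ b * Q x y z = 0.
  by apply: (mulfI nz); rewrite mulr0 -[RHS](g0 b).
split; apply: (mulfI F2).
  transitivity ((P x y z + (-1) ^+ false * Q x y z) + (P x y z + (-1) ^+ true * Q x y z)).
    by rewrite /= expr0 expr1; ring.
  by rewrite !E addr0 mulr0.
transitivity ((P x y z + (-1) ^+ false * Q x y z) - (P x y z + (-1) ^+ true * Q x y z)).
  by rewrite /= expr0 expr1; ring.
by rewrite !E subrr mulr0.
Qed.

End CauchyKovalevskaya.

(** * From polynomial spinors to coefficient arrays *)

Section DiracKernel.
Variable R : realType.
Local Notation C := (R[i]).
Local Notation Pol := {mpoly C[3]}.
Variables k1 k2 k3 : R.
Local Notation k := (kvec k1 k2 k3).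
Local Notation c1 := (rC k1).
Local Notation c2 := (rC k2).
Local Notation c3 := (rC k3).
Implicit Types (p : Pol) (u v : Cpt R) (b : bool).

Lemma iC2 : ('i%C : C) * 'i%C = -1. Proof. by rewrite -expr2 sqr_i. Qed.

Lemma iC_neq0 : ('i%C : C) != 0.
Proof. by apply: contra_eq_neq iC2 => ->; rewrite mul0r eq_sym oppr_eq0 oner_eq0. Qed.

Lemma C2_neq0 : (2 : C) != 0. Proof. by rewrite pnatr_eq0. Qed.

Lemma monX0 x y z : mon x y z 0 = x. Proof. by rewrite mnmE. Qed.
Lemma monX1 x y z : mon x y z 1 = y. Proof. by rewrite mnmE. Qed.
Lemma monX2 x y z : mon x y z 2 = z. Proof. by rewrite mnmE. Qed.

Lemma monD0 x y z : (mon x y z + U_(0%R))%MM = mon x.+1 y z.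
Proof. by apply/mnmP => -[[|[|[|//]]] lt_i]; rewrite !mnmE /= ?addn0 ?addn1. Qed.
Lemma monD1 x y z : (mon x y z + U_(1%R))%MM = mon x y.+1 z.
Proof. by apply/mnmP => -[[|[|[|//]]] lt_i]; rewrite !mnmE /= ?addn0 ?addn1. Qed.
Lemma monD2 x y z : (mon x y z + U_(2%R))%MM = mon x y z.+1.
Proof. by apply/mnmP => -[[|[|[|//]]] lt_i]; rewrite !mnmE /= ?addn0 ?addn1. Qed.

Lemma mcoeff_mulX0 p x y z :
  ('X_0 * p)@_(mon x y z) = co_x1 (fun x y z => p@_(mon x y z)) x y z.
Proof. by rewrite mcoeff_mulXi monX0; case: x => //= x; rewrite -monD0 addmK. Qed.
Lemma mcoeff_mulX1 p x y z :
  ('X_1 * p)@_(mon x y z) = co_x2 (fun x y z => p@_(mon x y z)) x y z.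
Proof. by rewrite mcoeff_mulXi monX1; case: y => //= y; rewrite -monD1 addmK. Qed.
Lemma mcoeff_mulX2 p x y z :
  ('X_2 * p)@_(mon x y z) = co_x3 (fun x y z => p@_(mon x y z)) x y z.
Proof. by rewrite mcoeff_mulXi monX2; case: z => //= z; rewrite -monD2 addmK. Qed.

Lemma mcoeff_dunkl0 p x y z :
  (dunkl k 0 p)@_(mon x y z) = co_T1 c1 (fun x y z => p@_(mon x y z)) x y z.
Proof. by rewrite mcoeff_dunkl monD0 monX0. Qed.
Lemma mcoeff_dunkl1 p x y z :
  (dunkl k 1 p)@_(mon x y z) = co_T2 c2 (fun x y z => p@_(mon x y z)) x y z.
Proof. by rewrite mcoeff_dunkl monD1 monX1. Qed.
Lemma mcoeff_dunkl2 p x y z :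
  (dunkl k 2 p)@_(mon x y z) = co_T3 c3 (fun x y z => p@_(mon x y z)) x y z.
Proof. by rewrite mcoeff_dunkl monD2 monX2. Qed.

Lemma mcoeff_refl0 p x y z :
  (reflp 0 p)@_(mon x y z) = co_R1 (fun x y z => p@_(mon x y z)) x y z.
Proof. by rewrite mcoeff_refl monX0. Qed.
Lemma mcoeff_refl1 p x y z :
  (reflp 1 p)@_(mon x y z) = co_R2 (fun x y z => p@_(mon x y z)) x y z.
Proof. by rewrite mcoeff_refl monX1. Qed.
Lemma mcoeff_refl2 p x y z :
  (reflp 2 p)@_(mon x y z) = co_R3 (fun x y z => p@_(mon x y z)) x y z.
Proof. by rewrite mcoeff_refl monX2. Qed.

(* A polynomial spinor is studied through the coefficients of its [e_1]-components. *)
Definition gs u := split_comp ('i%C : C)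
  (fun x y z => u.1@_(mon x y z)) (fun x y z => u.2@_(mon x y z)).

Lemma eq_split_comp I (P P' Q Q' : nat -> nat -> nat -> C) b x y z :
  P x y z = P' x y z -> Q x y z = Q' x y z ->
  split_comp I P Q b x y z = split_comp I P' Q' b x y z.
Proof. by rewrite /split_comp => -> ->. Qed.

Lemma gs_Dirac u b x y z : gs (Dirac k u) b x y z = op_D c1 c2 c3 (gs u) b x y z.
Proof.
rewrite -[RHS]split_comp_D; apply: eq_split_comp; rewrite /Dirac /e1 /e2 /e3 /pmap /=.
  rewrite 2!mcoeffD mcoeffN mcoeffZ; congr (_ - _ * _ + _).
  - exact: mcoeff_dunkl0.
  - exact: mcoeff_dunkl1.
  - exact: mcoeff_dunkl2.
rewrite 2!mcoeffD mcoeffN mcoeffZ; congr (_ + _ * _ - _).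
- exact: mcoeff_dunkl0.
- exact: mcoeff_dunkl1.
- exact: mcoeff_dunkl2.
Qed.

Lemma mcoeff_ang21 p P x y z : (forall x y z, p@_(mon x y z) = P x y z) ->
  (ang k 2 1 p)@_(mon x y z) = co_x3 (co_T2 c2 P) x y z - co_x2 (co_T3 c3 P) x y z.
Proof.
move=> pP; rewrite /ang mcoeffB; congr (_ - _).
  rewrite mcoeff_mulX2; case: z => //= z.
  by rewrite mcoeff_dunkl1 /co_T2 pP.
rewrite mcoeff_mulX1; case: y => //= y.
by rewrite mcoeff_dunkl2 /co_T3 pP.
Qed.

Lemma mcoeff_ang02 p P x y z : (forall x y z, p@_(mon x y z) = P x y z) ->
  (ang k 0 2 p)@_(mon x y z) = co_x1 (co_T3 c3 P) x y z - co_x3 (co_T1 c1 P) x y z.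
Proof.
move=> pP; rewrite /ang mcoeffB; congr (_ - _).
  rewrite mcoeff_mulX0; case: x => //= x.
  by rewrite mcoeff_dunkl2 /co_T3 pP.
rewrite mcoeff_mulX2; case: z => //= z.
by rewrite mcoeff_dunkl0 /co_T1 pP.
Qed.

Lemma mcoeff_ang10 p P x y z : (forall x y z, p@_(mon x y z) = P x y z) ->
  (ang k 1 0 p)@_(mon x y z) = co_x2 (co_T1 c1 P) x y z - co_x1 (co_T2 c2 P) x y z.
Proof.
move=> pP; rewrite /ang mcoeffB; congr (_ - _).
  rewrite mcoeff_mulX1; case: y => //= y.
  by rewrite mcoeff_dunkl0 /co_T1 pP.
rewrite mcoeff_mulX0; case: x => //= x.
by rewrite mcoeff_dunkl1 /co_T2 pP.
Qed.

Lemma mcoeff_refl12 p x y z : (reflp 1 (reflp 2 p))@_(mon x y z) =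
  co_R2 (co_R3 (fun x y z => p@_(mon x y z))) x y z.
Proof. by rewrite mcoeff_refl1 /co_R2 mcoeff_refl2. Qed.
Lemma mcoeff_refl02 p x y z : (reflp 0 (reflp 2 p))@_(mon x y z) =
  co_R1 (co_R3 (fun x y z => p@_(mon x y z))) x y z.
Proof. by rewrite mcoeff_refl0 /co_R1 mcoeff_refl2. Qed.
Lemma mcoeff_refl01 p x y z : (reflp 0 (reflp 1 p))@_(mon x y z) =
  co_R1 (co_R2 (fun x y z => p@_(mon x y z))) x y z.
Proof. by rewrite mcoeff_refl0 /co_R1 mcoeff_refl1. Qed.

Lemma mcoeff_lin4 (h i j l a b c d : C) p q r t m :
  p@_m = a -> q@_m = b -> r@_m = c -> t@_m = d ->
  (h *: p + i *: q + j *: r + l *: t)@_m = h * a + i * b + j * c + l * d.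
Proof. by move=> <- <- <- <-; rewrite !mcoeffD !mcoeffZ. Qed.

Lemma gs_biX u b x y z : gs (biX k u) b x y z = op_X c2 c3 (gs u) b x y z.
Proof.
rewrite -[RHS](split_comp_X _ _ iC2); apply: eq_split_comp.
  apply: mcoeff_lin4; [|exact: mcoeff_refl12|exact: mcoeff_refl2|exact: mcoeff_refl1].
  by apply: mcoeff_ang21 => *; exact: mcoeff_refl12.
apply: mcoeff_lin4; [|exact: mcoeff_refl12|exact: mcoeff_refl2|exact: mcoeff_refl1].
by apply: mcoeff_ang21 => *; exact: mcoeff_refl12.
Qed.

Lemma gs_biY u b x y z : gs (biY k u) b x y z = op_Y c1 c3 (gs u) b x y z.
Proof.
rewrite -[RHS](split_comp_Y _ _ iC2); apply: eq_split_comp.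
  apply: mcoeff_lin4; [|exact: mcoeff_refl02|exact: mcoeff_refl0|exact: mcoeff_refl2].
  by rewrite /= mcoeffN mcoeffZ (mcoeff_ang02 _ _ _ (mcoeff_refl02 _)).
apply: mcoeff_lin4; [|exact: mcoeff_refl02|exact: mcoeff_refl0|exact: mcoeff_refl2].
by rewrite /= mcoeffZ (mcoeff_ang02 _ _ _ (mcoeff_refl02 _)).
Qed.

Lemma gs_biZ u b x y z : gs (biZ k u) b x y z = op_Z c1 c2 (gs u) b x y z.
Proof.
rewrite -[RHS](split_comp_Z _ _ iC2); apply: eq_split_comp.
  apply: mcoeff_lin4; [|exact: mcoeff_refl01|exact: mcoeff_refl1|exact: mcoeff_refl0].
  by apply: mcoeff_ang10 => *; exact: mcoeff_refl01.
apply: mcoeff_lin4; [|exact: mcoeff_refl01|exact: mcoeff_refl1|exact: mcoeff_refl0].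
by rewrite /= mcoeffN (mcoeff_ang10 _ _ _ (mcoeff_refl01 _)).
Qed.

Lemma gs_linear b x y z a u v :
  gs (a *: u + v) b x y z = a * gs u b x y z + gs v b x y z.
Proof.
rewrite -split_comp_linear; apply: eq_split_comp; first by rewrite [LHS]mcoeffD mcoeffZ.
by rewrite [LHS]mcoeffD mcoeffZ.
Qed.

Lemma gs0P u x y z :
  (forall b, gs u b x y z = 0) <-> u.1@_(mon x y z) = 0 /\ u.2@_(mon x y z) = 0.
Proof. exact: (split_comp_eq0 iC_neq0 C2_neq0). Qed.

Definition vanishing (A : nat -> nat -> bool) u :=
  forall b x y z, A y z -> gs u b x y z = 0.

Lemma gs_eq0 u : (forall b x y z, gs u b x y z = 0) -> u = 0.
Proof.
move=> g0; case: u g0 => p q g0; congr pair; apply/mpolyP => m;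
by rewrite mcoeff0 (monE m); have /gs0P[] := fun b => g0 b (m ord0) (m (inord 1)) (m (inord 2)).
Qed.

Lemma gsC0 b x y z : gs 0 b x y z = 0.
Proof. by rewrite /gs /split_comp /= !mcoeff0 mulr0 addr0 mulr0. Qed.

Lemma mdeg_mon x y z : mdeg (mon x y z) = (x + y + z)%N.
Proof. by rewrite mdegE 3!big_ord_recl big_ord0 !mnmE /= addn0 addnA. Qed.

Lemma MnP n u : reflect
  [/\ forall b x y z, (x + y + z)%N != n -> gs u b x y z = 0 &
      forall b x y z, dirac_row c1 c2 c3 (gs u) b x y z = 0] (u \in Mn k n).
Proof.
rewrite !inE; apply: (iffP andP) => [[/andP[h1 h2] /eqP D0]|[g_hom g_ker]]; split.
- move=> b x y z ne; move: b; apply/gs0P; rewrite -mdeg_mon in ne.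
  by rewrite !(dhomog_nemf_coeff _ ne).
- move=> b x y z; have := gs_Dirac u b x y z; rewrite D0 gsC0 => /esym/eqP.
  by rewrite mulf_eq0 signr_eq0 => /eqP.
- apply/andP; split; apply/dhomogP => m; rewrite mcoeff_msupp; apply: contraNeq;
    rewrite (monE m) => ne; apply/eqP;
    have {}ne := etrans (congr1 (eq_op^~ n) (esym (mdeg_mon _ _ _))) (negbTE ne);
    by have /gs0P[] := fun b => g_hom b _ _ _ (negbT ne).
apply/eqP; apply: gs_eq0 => b x y z.
by rewrite gs_Dirac /op_D g_ker mulr0.
Qed.

Lemma Mx1P t n u : reflect (u \in Mn k n /\ vanishing (fun y z => y < t)%N u) (u \in Mx k 1 t n).
Proof.
rewrite [in X in reflect _ X]inE -andbA; apply: (iffP and3P) => [[uM v1 v2]|[uM van]].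
  split=> // b x y z lt; move: b; apply/gs0P; split; apply/eqP; rewrite mcoeff_eq0.
    by apply: contraL lt => /(allP v1); rewrite monX1 -leqNgt.
  by apply: contraL lt => /(allP v2); rewrite monX1 -leqNgt.
split=> //; apply/allP => m; rewrite mcoeff_msupp; apply: contraR; rewrite -ltnNge.
  rewrite {1 2}(monE m) monX1 => lt.
  by have /gs0P[-> _] := fun b => van b (m ord0) _ (m (inord 2)) lt.
rewrite {1 2}(monE m) monX1 => lt.
by have /gs0P[_ ->] := fun b => van b (m ord0) _ (m (inord 2)) lt.
Qed.

Lemma Mx2P t n u : reflect (u \in Mn k n /\ vanishing (fun y z => z < t)%N u) (u \in Mx k 2 t n).
Proof.
rewrite [in X in reflect _ X]inE -andbA; apply: (iffP and3P) => [[uM v1 v2]|[uM van]].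
  split=> // b x y z lt; move: b; apply/gs0P; split; apply/eqP; rewrite mcoeff_eq0.
    by apply: contraL lt => /(allP v1); rewrite monX2 -leqNgt.
  by apply: contraL lt => /(allP v2); rewrite monX2 -leqNgt.
split=> //; apply/allP => m; rewrite mcoeff_msupp; apply: contraR; rewrite -ltnNge.
  rewrite {1 2}(monE m) monX2 => lt.
  by have /gs0P[-> _] := fun b => van b (m ord0) (m (inord 1)) _ lt.
rewrite {1 2}(monE m) monX2 => lt.
by have /gs0P[_ ->] := fun b => van b (m ord0) (m (inord 1)) _ lt.
Qed.

End DiracKernel.

(** * Submodules of Mn given by vanishing coefficients *)

Section Submodules.
Variable R : realType.
Local Notation C := (R[i]).
Variables (k1 k2 k3 : R) (n : nat).
Local Notation k := (kvec k1 k2 k3).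
Local Notation c1 := (rC k1).
Local Notation c2 := (rC k2).
Local Notation c3 := (rC k3).
Implicit Types (u v : Cpt R) (b : bool) (A : nat -> nat -> bool).

Lemma gs_biYZ u b x y z :
  gs (biY k (biZ k u)) b x y z = op_Y c1 c3 (op_Z c1 c2 (gs u)) b x y z.
Proof.
rewrite gs_biY /op_Y !gs_biZ; congr (_ * (_ - _) + _).
  by case: z => // z; rewrite gs_biZ.
by case: x => // x; rewrite gs_biZ.
Qed.

Lemma gs_biZY u b x y z :
  gs (biZ k (biY k u)) b x y z = op_Z c1 c2 (op_Y c1 c3 (gs u)) b x y z.
Proof.
rewrite gs_biZ /op_Z !gs_biY; congr (_ * (_ + _) + _).
  by case: y => // y; rewrite gs_biY.
by case: x => // x; rewrite gs_biY.
Qed.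

Lemma op_X_zero (g : bool -> nat -> nat -> nat -> C) b x y z :
  (forall x' y' z', (x' + y' + z' = x + y + z)%N -> forall b', g b' x' y' z' = 0) ->
  op_X c2 c3 g b x y z = 0.
Proof.
move=> g0; rewrite /op_X (g0 x) // mulr0 addr0.
case: y g0 => [|y] g0; case: z g0 => [|z] g0; rewrite ?g0 ?mulr0 ?addr0 ?mulr0 //; lia.
Qed.

Lemma op_Y_zero (g : bool -> nat -> nat -> nat -> C) b x y z :
  (forall x' y' z', (x' + y' + z' = x + y + z)%N -> forall b', g b' x' y' z' = 0) ->
  op_Y c1 c3 g b x y z = 0.
Proof.
move=> g0; rewrite /op_Y (g0 x) // mulr0 addr0.
case: x g0 => [|x] g0; case: z g0 => [|z] g0; rewrite ?g0 ?mulr0 ?subr0 ?mulr0 //; lia.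
Qed.

Lemma op_Z_zero (g : bool -> nat -> nat -> nat -> C) b x y z :
  (forall x' y' z', (x' + y' + z' = x + y + z)%N -> forall b', g b' x' y' z' = 0) ->
  op_Z c1 c2 g b x y z = 0.
Proof.
move=> g0; rewrite /op_Z (g0 x) // mulr0 addr0.
case: x g0 => [|x] g0; case: y g0 => [|y] g0; rewrite ?g0 ?mulr0 ?addr0 ?mulr0 //; lia.
Qed.

Lemma Mn_biop j u : u \in Mn k n -> biop k j u \in Mn k n.
Proof.
move=> /MnP[g_hom g_ker].
have D0 b x y z : op_D c1 c2 c3 (gs u) b x y z = 0 by rewrite /op_D g_ker mulr0.
have ker (op : (bool -> nat -> nat -> nat -> C) -> bool -> nat -> nat -> nat -> C) v :
    (forall b x y z, gs v b x y z = op (gs u) b x y z) ->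
    (forall b x y z, op_D c1 c2 c3 (op (gs u)) b x y z = op (op_D c1 c2 c3 (gs u)) b x y z) ->
    (forall g b x y z, (forall x' y' z', (x' + y' + z' = x + y + z)%N ->
      forall b', g b' x' y' z' = 0) -> op g b x y z = 0) -> v \in Mn k n.
  move=> vE opD op0; apply/MnP; split=> b x y z.
    by move=> ne; rewrite vE op0 // => x' y' z' E b'; rewrite g_hom // E.
  have := opD b x y z; rewrite op0 // /op_D => /eqP; rewrite mulf_eq0 signr_eq0 /=.
  by move/eqP; rewrite /dirac_row !vE.
rewrite /biop; case: (val j) => [|[|m]].
- by apply: (ker (op_X c2 c3)) => *; [exact: gs_biX | apply: op_DX; exact: C2_neq0 | exact: op_X_zero].
- by apply: (ker (op_Y c1 c3)) => *; [exact: gs_biY | apply: op_DY; exact: C2_neq0 | exact: op_Y_zero].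
by apply: (ker (op_Z c1 c2)) => *; [exact: gs_biZ | apply: op_DZ; exact: C2_neq0 | exact: op_Z_zero].
Qed.

(* Vanishing of all coefficients at exponents [(y, z)] of [x_2, x_3] in [A] is
   then preserved by [biop]: the step [y -> y.+1] is either blocked by
   [dbr k_2 y.+1 = 0], as for [y.+1 = t_2], or stays in [A]. *)
Definition stable_zeros A :=
  [/\ forall y z, A y.+1 z -> A y z, forall y z, A y z.+1 -> A y z,
      forall y z, A y z -> dbr c2 y.+1 = 0 \/ A y.+1 z &
      forall y z, A y z -> dbr c3 z.+1 = 0 \/ A y z.+1].

Lemma vanishing_biop A j u : stable_zeros A -> vanishing A u -> vanishing A (biop k j u).
Proof.
move=> [dn2 dn3 up2 up3] u0 b x y z Ayz; rewrite /biop.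
have up2' y' z' b' x' : A y' z' -> dbr c2 y'.+1 * gs u b' x' y'.+1 z' = 0.
  by move=> Ay; have [->|/u0 ->] := up2 _ _ Ay; rewrite ?mul0r ?mulr0.
have up3' y' z' b' x' : A y' z' -> dbr c3 z'.+1 * gs u b' x' y' z'.+1 = 0.
  by move=> Ay; have [->|/u0 ->] := up3 _ _ Ay; rewrite ?mul0r ?mulr0.
case: (val j) => [|[|m]]; rewrite ?(gs_biX, gs_biY, gs_biZ).
- rewrite /op_X (u0 _ _ _ _ Ayz) mulr0 addr0.
  have -> : (if z is z'.+1 then dbr c2 y.+1 * gs u b x y.+1 z' else 0) = 0.
    by case: z Ayz => // z /dn3; exact: up2'.
  have -> : (if y is y'.+1 then dbr c3 z.+1 * gs u b x y' z.+1 else 0) = 0.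
    by case: y Ayz => // y /dn2; exact: up3'.
  by rewrite addr0 mulr0.
- rewrite /op_Y (u0 _ _ _ _ Ayz) mulr0 addr0.
  have -> : (if z is z'.+1 then dbr c1 x.+1 * gs u (~~ b) x.+1 y z' else 0) = 0.
    by case: z Ayz => // z /dn3/u0 ->; rewrite mulr0.
  have -> : (if x is x'.+1 then dbr c3 z.+1 * gs u (~~ b) x' y z.+1 else 0) = 0.
    by case: x => // x; exact: up3'.
  by rewrite subr0 mulr0.
rewrite /op_Z (u0 _ _ _ _ Ayz) mulr0 addr0.
have -> : (if y is y'.+1 then dbr c1 x.+1 * gs u (~~ b) x.+1 y' z else 0) = 0.
  by case: y Ayz => // y /dn2/u0 ->; rewrite mulr0.
have -> : (if x is x'.+1 then dbr c2 y.+1 * gs u (~~ b) x' y.+1 z else 0) = 0.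
  by case: x => // x; exact: up2'.
by rewrite addr0 mulr0.
Qed.

Lemma submod_vanishing A (S : pred (Cpt R)) : stable_zeros A ->
  (forall u, u \in S <-> u \in Mn k n /\ vanishing A u) -> submod (biop k) S.
Proof.
move=> stA SE; split.
- apply/SE; split=> [|b x y z _]; last exact: gsC0.
  by apply/MnP; split=> *; rewrite /dirac_row !gsC0 ?mulr0 ?addr0.
- move=> a u v /SE[/MnP[uh uk] u0] /SE[/MnP[vh vk] v0]; apply/SE; split.
    apply/MnP; split=> b x y z.
      by move=> ne; rewrite gs_linear uh // vh // mulr0 addr0.
    transitivity (a * dirac_row c1 c2 c3 (gs u) b x y z + dirac_row c1 c2 c3 (gs v) b x y z).
      by rewrite -dirac_row_linear /dirac_row !gs_linear.
    by rewrite uk vk mulr0 addr0.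
  by move=> b x y z Ayz; rewrite gs_linear u0 // v0 // mulr0 addr0.
move=> j u /SE[uM u0]; apply/SE; split; first exact: Mn_biop.
exact: vanishing_biop.
Qed.

Hypothesis k1_neq0 : forall x, (0 < x <= n)%N -> dbr c1 x != 0.

(** Membership in such a submodule is thus decided on the restriction to x_1 = 0. *)
Lemma vanishing_restrict A u : stable_zeros A -> u \in Mn k n ->
  (forall b y z, (y + z = n)%N -> A y z -> gs u b 0 y z = 0) -> vanishing A u.
Proof.
move=> [_ _ up2 up3] /MnP[uh uk] u0.
apply: (support_ker uk k1_neq0 uh up2 up3) => b y z Ayz.
by have [E|ne] := eqVneq (y + z)%N n; [exact: u0 | exact: uh].
Qed.

Lemma Mn_extend (g0 : bool -> nat -> nat -> C) :
  exists2 u, u \in Mn k n & forall b y z, (y + z = n)%N -> gs u b 0 y z = g0 b y z.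
Proof.
have [g [g_hom g_ker gE]] := ck_exists c2 c3 g0 k1_neq0.
have [P [Q [PQ P0 Q0]]] := split_comp_onto (@iC_neq0 R) (@C2_neq0 R) g.
pose poly (P : nat -> nat -> nat -> C) : {mpoly C[3]} :=
  \sum_(m : 'X_{1..3 < n.+1})
    P ((m : 'X_{1..3}) ord0) ((m : 'X_{1..3}) (inord 1)) ((m : 'X_{1..3}) (inord 2))
      *: 'X_[m].
have polyE (P' : nat -> nat -> nat -> C) x y z :
    (forall x y z, (forall b, g b x y z = 0) -> P' x y z = 0) ->
    (poly P')@_(mon x y z) = P' x y z.
  move=> P'0.
  have mE : [/\ mon x y z ord0 = x, mon x y z (inord 1) = y & mon x y z (inord 2) = z].
    by rewrite !mnmE !inordK.
  have [le|lt] := leqP (x + y + z) n.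
    rewrite /poly (mcoeff_mpoly (fun m => P' (m ord0) (m (inord 1)) (m (inord 2)))); last first.
      by rewrite mdeg_mon ltnS.
    by case: mE => -> -> ->.
  rewrite P'0 => [|b]; last by rewrite g_hom // gtn_eqF.
  rewrite raddf_sum big1 //= => m _; rewrite mcoeffZ mcoeffX.
  case: eqP => [E|_]; last by rewrite mulr0.
  by have := bmdeg m; rewrite E mdeg_mon ltnS leqNgt lt.
have gsE b x y z : gs (poly P, poly Q) b x y z = g b x y z.
  by rewrite -PQ; apply: eq_split_comp; rewrite polyE.
exists (poly P, poly Q); last by move=> b y z E; rewrite gsE gE.
apply/MnP; split=> b x y z; first by move=> ne; rewrite gsE g_hom.
by rewrite -[RHS](g_ker b x y z) /dirac_row !gsE.
Qed.

End Submodules.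

(** * Sections of the coefficient line as twisted O-modules *)

Section Windows.
Variable R : realType.
Local Notation C := (R[i]).
Variables (k1 k2 k3 : R) (n : nat).
Local Notation k := (kvec k1 k2 k3).
Local Notation c1 := (rC k1).
Local Notation c2 := (rC k2).
Local Notation c3 := (rC k3).
Hypothesis even_n : ~~ odd n.
Hypothesis k1_neq0 : forall x, (0 < x <= n)%N -> dbr c1 x != 0.
Variables (AS AU : nat -> nat -> bool) (S U : pred (Cpt R)).
Hypothesis SE : forall u, u \in S <-> u \in Mn k n /\ vanishing AS u.
Hypothesis UE : forall u, u \in U <-> u \in Mn k n /\ vanishing AU u.
Hypothesis stAS : stable_zeros k2 k3 AS.
Hypothesis stAU : stable_zeros k2 k3 AU.
Variables (d : nat) (a b c : C) (W : bimx C d.+1) (sL sR : C).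
Hypothesis even_d : ~~ odd d.
Hypothesis sLR : sL * sR = -1.
Hypothesis W0 : W ord0 = - OZ d a b c.
Hypothesis kappa : 2 * a * b - c * d.+1%:R = - lamX c1 c2 c3 n.

Let S_ops j u : u \in S -> biop k j u \in S.
Proof.
by move=> /SE[uM u0]; apply/SE; split; [exact: Mn_biop | exact: vanishing_biop].
Qed.

Let S_sub : submod (biop k) S. Proof. exact: submod_vanishing SE. Qed.
Let U_sub : submod (biop k) U. Proof. exact: submod_vanishing UE. Qed.

Lemma sign_cancel (T : comPzRingType) (e i : nat) (p q : T) :
  - ((-1) ^+ e * (-1) ^+ i.+1 * p) * - ((-1) ^+ e * (-1) ^+ i * q) = - (q * p).
Proof. by rewrite !signr_odd2 /=; case: (odd e); case: (odd i) => /=; ring. Qed.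

Variables jY jZ : 'I_3.
Hypothesis biopY : biop k jY = biY k.
Hypothesis biopZ : biop k jZ = biZ k.
Hypothesis j3 : forall j, [\/ j = ord0, j = jY | j = jZ].

Let biopX : biop k ord0 = biX k := erefl.

Let gs_X u e y z : u \in S -> (y + z = n)%N ->
  gs (biX k u) e 0 y z = gs (biY k (biZ k u)) e 0 y z + gs (biZ k (biY k u)) e 0 y z
    + (2 * a * b - c * d.+1%:R) * gs u e 0 y z.
Proof.
move=> /SE[/MnP[_ uk] _] E; apply: etrans (gs_biX k1 k2 k3 u e 0 y z) _.
have even_yz : ~~ odd (y + z) by rewrite E.
apply: etrans (op_X0 (C2_neq0 R) e uk even_yz) _.
by rewrite -gs_biYZ -gs_biZY kappa mulNr E.
Qed.

Let gs_X' u e y z : u \in S -> (y + z = n)%N ->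
  gs (biX k u) e 0 y z = gs (biZ k (biY k u)) e 0 y z + gs (biY k (biZ k u)) e 0 y z
    + (2 * a * b - c * d.+1%:R) * gs u e 0 y z.
Proof.
have swap (t v w q : C) : t = v + w + q -> t = w + v + q by rewrite (addrC v).
by move=> uS E; apply: swap; exact: gs_X.
Qed.

Let sgn_n y z : (y + z = n)%N -> (-1) ^+ y = (-1) ^+ z :> C.
Proof.
by move=> E; move: even_n; rewrite -E oddD !signr_odd2; case: odd; case: odd.
Qed.

(* At [x_1 = 0] the coefficients of degree [n] form a line indexed by [y + z = n];
   along it [Z] is lower and [Y] upper bidiagonal. The quotient [S / U] keeps the
   window [o <= y <= o + d]. *)
Section ZLower.
Variable o : nat.
Hypothesis le_od_n : (o + d <= n)%N.
Hypothesis WL : W jZ = sL *: OX d a.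
Hypothesis WR : W jY = sR *: OY d a b c.
Hypothesis eL : forall i, (i <= d)%N ->
  sL * Otheta d a i = (-1) ^+ (o + i) * (dbr c2 (o + i) + 2^-1 + c1) + c2.
Hypothesis eR : forall i, (i <= d)%N ->
  sR * Otheta d b i = (-1) ^+ (o + i) * (dbr c3 (n - o - i) + 2^-1 + c1) + c3.
Hypothesis ephi : forall i, (i < d)%N ->
  Ophi d a b c i.+1 = dbr c2 (o + i).+1 * dbr c3 (n - o - i).
Hypothesis c3_neq0 : forall i, (i < d)%N -> dbr c3 (n - o - i) != 0.
(** [bottom] and [top] decouple the window from the rest of the line: a neighbouring coefficient
    vanishes on [S], or it lies off the line, or, at the top, its factor [dbr c2] is zero. *)
Hypothesis bottom : forall o', o = o'.+1 -> AS o' (n - o').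
Hypothesis top : (o + d < n)%N ->
  dbr c2 (o + d).+1 = 0 \/ AS (o + d).+1 (n - (o + d).+1).
Hypothesis AS_window : forall y z, (y + z = n)%N -> AS y z -> ~~ (o <= y <= o + d)%N.
Hypothesis AU_window : forall y z, (y + z = n)%N ->
  AU y z = AS y z || (o <= y <= o + d)%N.

Let G e i (u : Cpt R) := gs u e 0 (o + i) (n - o - i).
Let l (e : bool) i : C := - ((-1) ^+ e * (-1) ^+ (o + i).+1 * dbr c3 (n - o - i)).
Let r (e : bool) i : C := - ((-1) ^+ e * (-1) ^+ (o + i) * dbr c2 (o + i).+1).

Let GL0 e u : u \in S -> G e 0 (biop k jZ u) = sL * Otheta d a 0 * G e 0 u.
Proof.
move=> /SE[/MnP[_ uk] u0]; rewrite biopZ /G gs_biZ (op_Z0 uk) -eL // addn0.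
case: (o) bottom le_od_n => [|o'] btm le; first by rewrite subr0.
have A : AS o' (n - o'.+1 - 0).+1.
  by rewrite (_ : (n - o'.+1 - 0).+1 = n - o')%N; [exact: btm | lia].
by rewrite (u0 _ _ _ _ A) mulr0 subr0.
Qed.

Let GL e i u : u \in S -> (i < d)%N ->
  G e i.+1 (biop k jZ u) = sL * Otheta d a i.+1 * G e i.+1 u + l e i * G e i u.
Proof.
move=> /SE[/MnP[_ uk] u0] lt; rewrite biopZ /G gs_biZ (op_Z0 uk) -eL // addnS /l mulNr.
by rewrite (_ : (n - o - i.+1).+1 = n - o - i)%N //; move: le_od_n; lia.
Qed.

Let GR e i u : u \in S -> (i < d)%N ->
  G e i (biop k jY u) = sR * Otheta d b i * G e i u + r e i * G e i.+1 u.
Proof.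
move=> /SE[/MnP[_ uk] u0] lt; rewrite biopY /G gs_biY (op_Y0 uk) eR ?(ltnW lt) // addnS /r mulNr.
have <- : (-1) ^+ (n - o - i) = (-1) ^+ (o + i) :> C by apply: sgn_n; move: le_od_n; lia.
have -> : (n - o - i.+1 = (n - o - i).-1)%N by rewrite subnS.
by case zE: (n - o - i)%N => [|z] //; move: le_od_n zE; lia.
Qed.

Let GRd e u : u \in S -> G e d (biop k jY u) = sR * Otheta d b d * G e d u.
Proof.
move=> /SE[/MnP[_ uk] u0]; rewrite biopY /G gs_biY (op_Y0 uk) eR //.
have <- : (-1) ^+ (n - o - d) = (-1) ^+ (o + d) :> C by apply: sgn_n; move: le_od_n; lia.
case zE: (n - o - d)%N => [|z]; first by rewrite subr0.
have lt : (o + d < n)%N by move: zE; lia.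
have [->|A] := top lt; first by rewrite mulr0 mul0r subr0.
have {}A : AS (o + d).+1 z by rewrite (_ : z = n - (o + d).+1)%N //; move: zE; lia.
by rewrite (u0 _ _ _ _ A) mulr0 subr0.
Qed.

Let GX e i u : u \in S -> (i <= d)%N ->
  G e i (biop k ord0 u) = G e i (biop k jZ (biop k jY u))
    + G e i (biop k jY (biop k jZ u)) + (2 * a * b - c * d.+1%:R) * G e i u.
Proof.
move=> uS le; have E : (o + i + (n - o - i) = n)%N by move: le_od_n; lia.
by rewrite biopX biopY biopZ; exact: gs_X'.
Qed.

Let l_neq0 e i : (i < d)%N -> l e i != 0.
Proof. by move=> lt; rewrite oppr_eq0 !mulf_neq0 ?signr_eq0 ?c3_neq0. Qed.

Let lr e i : (i < d)%N -> l e i * r e i = - Ophi d a b c i.+1.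
Proof. by move=> lt; rewrite /l /r sign_cancel ephi. Qed.

Let G_onto (h : bool -> nat -> C) :
  exists2 u, u \in S & forall e i, (i <= d)%N -> G e i u = h e i.
Proof.
have [u uM uE] := Mn_extend k2 k3 k1_neq0 (fun e y z => if (o <= y <= o + d)%N then h e (y - o)%N else 0).
exists u => [|e i le_i_d].
  apply/SE; split; first exact: uM.
  apply: (vanishing_restrict k1_neq0 stAS uM) => e y z E Ayz.
  by rewrite (uE e y z E) (negPf (AS_window E Ayz)).
have E : (o + i + (n - o - i) = n)%N by move: le_od_n; lia.
rewrite /G (uE e _ _ E).
by rewrite leq_addr leq_add2l le_i_d addnC addnK.
Qed.

Let G_ker u : u \in S -> (forall e i, (i <= d)%N -> G e i u = 0) -> vanishing AU u.
Proof.
move=> /SE[uM u0] G0; apply: (vanishing_restrict k1_neq0 stAU uM) => e y z E.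
rewrite (AU_window E) => /orP[|/andP[le1 le2]]; first exact: u0.
have le : (y - o <= d)%N by lia.
have := G0 e _ le; rewrite /G (_ : o + (y - o) = y)%N; last by lia.
by rewrite (_ : n - o - (y - o) = z)%N //; lia.
Qed.

Let G_linear e i x u v : G e i (x *: u + v) = x * G e i u + G e i v.
Proof. exact: gs_linear. Qed.

Let j3' j : [\/ j = ord0, j = jZ | j = jY].
Proof. by case: (j3 j); [constructor 1 | constructor 3 | constructor 2]. Qed.

Lemma Z_window_quot : {subset U <= S} -> quot_iso (biop k) S U (dsum2 W).
Proof.
move=> US; apply: (coordinates_quot_iso even_d j3' sLR W0 WL WR S_ops G_linear
  l_neq0 lr GL0 GL GR GRd GX S_sub U_sub US G_onto) => u uS.
split=> [/UE[_ u0] e i le_i_d|/(G_ker uS) u0]; last first.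
  by apply/UE; split=> //; have /SE[] := uS.
apply: u0; rewrite AU_window; last by move: le_od_n; lia.
by rewrite leq_addr leq_add2l le_i_d orbT.
Qed.

Lemma Z_window_iso : (forall y z, AU y z) -> iso_mx (biop k) S (dsum2 W).
Proof.
move=> AU1; apply: (coordinates_iso_mx even_d j3' sLR W0 WL WR S_ops G_linear
  l_neq0 lr GL0 GL GR GRd GX S_sub G_onto) => u uS /(G_ker uS) u0.
by apply: gs_eq0 => e x y z; apply: u0.
Qed.

End ZLower.

(* The same line read in the direction of [z]: now [Y] is lower bidiagonal. *)
Section YLower.
Hypothesis le_d_n : (d <= n)%N.
Hypothesis WL : W jY = sL *: OX d a.
Hypothesis WR : W jZ = sR *: OY d a b c.
Hypothesis eL : forall i, (i <= d)%N ->
  sL * Otheta d a i = (-1) ^+ i * (dbr c3 i + 2^-1 + c1) + c3.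
Hypothesis eR : forall i, (i <= d)%N ->
  sR * Otheta d b i = (-1) ^+ i * (dbr c2 (n - i) + 2^-1 + c1) + c2.
Hypothesis ephi : forall i, (i < d)%N ->
  Ophi d a b c i.+1 = dbr c3 i.+1 * dbr c2 (n - i).
Hypothesis c2_neq0 : forall i, (i < d)%N -> dbr c2 (n - i) != 0.
Hypothesis top : (d < n)%N -> dbr c3 d.+1 = 0 \/ AS (n - d.+1) d.+1.
Hypothesis AS_window : forall y z, (y + z = n)%N -> AS y z -> ~~ (z <= d)%N.
Hypothesis AU_window : forall y z, (y + z = n)%N -> AU y z = AS y z || (z <= d)%N.

Let G e i (u : Cpt R) := gs u e 0 (n - i) i.
Let l (e : bool) i : C := - ((-1) ^+ e * (-1) ^+ i.+1 * dbr c2 (n - i)).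
Let r (e : bool) i : C := - ((-1) ^+ e * (-1) ^+ i * dbr c3 i.+1).

Let GL0 e u : u \in S -> G e 0 (biop k jY u) = sL * Otheta d a 0 * G e 0 u.
Proof.
by move=> /SE[/MnP[_ uk] u0]; rewrite biopY /G gs_biY (op_Y0 uk) -eL // subr0.
Qed.

Let GL e i u : u \in S -> (i < d)%N ->
  G e i.+1 (biop k jY u) = sL * Otheta d a i.+1 * G e i.+1 u + l e i * G e i u.
Proof.
move=> /SE[/MnP[_ uk] u0] lt; rewrite biopY /G gs_biY (op_Y0 uk) -eL // /l mulNr.
by rewrite (_ : (n - i.+1).+1 = n - i)%N //; move: le_d_n; lia.
Qed.

Let GR e i u : u \in S -> (i < d)%N ->
  G e i (biop k jZ u) = sR * Otheta d b i * G e i u + r e i * G e i.+1 u.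
Proof.
move=> /SE[/MnP[_ uk] u0] lt; rewrite biopZ /G gs_biZ (op_Z0 uk) eR ?(ltnW lt) // /r mulNr.
have <- : (-1) ^+ (n - i) = (-1) ^+ i :> C by apply: sgn_n; move: le_d_n; lia.
have -> : (n - i.+1 = (n - i).-1)%N by rewrite subnS.
by case zE: (n - i)%N => [|z] //; move: le_d_n zE; lia.
Qed.

Let GRd e u : u \in S -> G e d (biop k jZ u) = sR * Otheta d b d * G e d u.
Proof.
move=> /SE[/MnP[_ uk] u0]; rewrite biopZ /G gs_biZ (op_Z0 uk) eR //.
have <- : (-1) ^+ (n - d) = (-1) ^+ d :> C by apply: sgn_n; move: le_d_n; lia.
case zE: (n - d)%N => [|z]; first by rewrite subr0.
have lt : (d < n)%N by move: zE; lia.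
have [->|A] := top lt; first by rewrite mulr0 mul0r subr0.
have {}A : AS z d.+1 by rewrite (_ : z = n - d.+1)%N //; move: zE; lia.
by rewrite (u0 _ _ _ _ A) mulr0 subr0.
Qed.

Let GX e i u : u \in S -> (i <= d)%N ->
  G e i (biop k ord0 u) = G e i (biop k jY (biop k jZ u))
    + G e i (biop k jZ (biop k jY u)) + (2 * a * b - c * d.+1%:R) * G e i u.
Proof.
move=> uS le; have E : (n - i + i = n)%N by move: le_d_n; lia.
by rewrite biopX biopY biopZ; exact: gs_X.
Qed.

Let l_neq0 e i : (i < d)%N -> l e i != 0.
Proof. by move=> lt; rewrite oppr_eq0 !mulf_neq0 ?signr_eq0 ?c2_neq0. Qed.

Let lr e i : (i < d)%N -> l e i * r e i = - Ophi d a b c i.+1.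
Proof. by move=> lt; rewrite /l /r sign_cancel ephi. Qed.

Let G_onto (h : bool -> nat -> C) :
  exists2 u, u \in S & forall e i, (i <= d)%N -> G e i u = h e i.
Proof.
have [u uM uE] := Mn_extend k2 k3 k1_neq0 (fun e y z => if (z <= d)%N then h e z else 0).
exists u => [|e i le_i_d].
  apply/SE; split; first exact: uM.
  apply: (vanishing_restrict k1_neq0 stAS uM) => e y z E Ayz.
  by rewrite (uE e y z E) (negPf (AS_window E Ayz)).
have E : (n - i + i = n)%N by move: le_d_n; lia.
by rewrite /G (uE e _ _ E) le_i_d.
Qed.

Let G_ker u : u \in S -> (forall e i, (i <= d)%N -> G e i u = 0) -> vanishing AU u.
Proof.
move=> /SE[uM u0] G0; apply: (vanishing_restrict k1_neq0 stAU uM) => e y z E.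
rewrite (AU_window E) => /orP[|le]; first exact: u0.
by have := G0 e _ le; rewrite /G (_ : n - z = y)%N //; lia.
Qed.

Let G_linear e i x u v : G e i (x *: u + v) = x * G e i u + G e i v.
Proof. exact: gs_linear. Qed.

Lemma Y_window_quot : {subset U <= S} -> quot_iso (biop k) S U (dsum2 W).
Proof.
move=> US; apply: (coordinates_quot_iso even_d j3 sLR W0 WL WR S_ops G_linear
  l_neq0 lr GL0 GL GR GRd GX S_sub U_sub US G_onto) => u uS.
split=> [/UE[_ u0] e i le_i_d|/(G_ker uS) u0]; last first.
  by apply/UE; split=> //; have /SE[] := uS.
apply: u0; rewrite AU_window; last by move: le_d_n; lia.
by rewrite le_i_d orbT.
Qed.

End YLower.
End Windows.


Section Assembly.
Variable R : realType.
Variables (k1 k2 k3 : R) (n t2 t3 : nat).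
Local Notation C := (R[i]).
Local Notation c1 := (rC k1).
Local Notation c2 := (rC k2).
Local Notation c3 := (rC k3).
Local Notation k := (kvec k1 k2 k3).
Local Notation N := (n.+1%:R / 2 : C).
Local Notation K := (c1 + c2 + c3).
Local Notation M := (Mn k n).
Local Notation M2 := (Mx k 1 t2 n).
Local Notation M3 := (Mx k 2 t3 n).
Local Notation M23 := [predI M2 & M3].
Local Notation W1 := (twist aut_m1p1 perm13
  (Omod (n - t2 - t3) (c1 + c3 + N) (- c1 - c2 - N) (- N))).
Local Notation W2 := (twist aut_p1m1 perm13 (Omod t2.-1 c1 (- K - n.+1%:R) (- c3))).
Local Notation W3 := (twist aut_p1m1 perm132 (Omod t3.-1 c1 (- K - n.+1%:R) (- c2))).

Lemma biop_1 (l : 'I_3 -> R) : biop l (inord 1) = biY l.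
Proof. by rewrite /biop (_ : val _ = 1%N) //= inordK. Qed.

Lemma biop_2 (l : 'I_3 -> R) : biop l (inord 2) = biZ l.
Proof. by rewrite /biop (_ : val _ = 2%N) //= inordK. Qed.

Lemma rC_tparam (x : R) t : 2 * x = - t%:R -> 2 * rC x = - t%:R.
Proof.
move=> /(congr1 (@rC R)); rewrite /rC rmorphM rmorphN !rmorph_nat; exact.
Qed.

(** A zero of [dbr] at an odd [x] would make [x] a value of t_1 not exceeding [n]. The quantified
    form also covers t_1 infinite. *)
Lemma rC_dbr_neq0 : (forall t, tparam k1 t -> (n < t)%N) ->
  forall x, (0 < x <= n)%N -> dbr c1 x != 0.
Proof.
move=> t1 x /andP[x_gt0 le_x_n]; rewrite /dbr; case: ifP => odd_x.
  apply/negP => /eqP E; suffices /t1 : tparam k1 x by rewrite ltnNge le_x_n.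
  split=> //; apply/eqP; rewrite -addr_eq0 addrC; apply/eqP.
  apply: (@complexI R); rewrite rmorphD rmorphM !rmorph_nat rmorph0; exact: E.
by rewrite addr0 pnatr_eq0 -lt0n.
Qed.

Hypothesis even_n : ~~ odd n.
Hypothesis odd_t2 : odd t2.
Hypothesis odd_t3 : odd t3.
Hypothesis c2E : 2 * c2 = - t2%:R.
Hypothesis c3E : 2 * c3 = - t3%:R.
Hypothesis le_t_n : (t2 + t3 <= n)%N.
Hypothesis k1_neq0 : forall x, (0 < x <= n)%N -> dbr c1 x != 0.

Let A2 (y z : nat) := (y < t2)%N.
Let A3 (y z : nat) := (z < t3)%N.
Let A23 (y z : nat) := (y < t2)%N || (z < t3)%N.
Let A0 (y z : nat) := false.
(** The pattern of the zero submodule, by which [M23] is itself treated as a window. *)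
Let A1 (y z : nat) := true.

Let ME u : u \in M <-> u \in M /\ vanishing A0 u.
Proof. by split=> [uM|[]//]; split. Qed.
Let M2E u : u \in M2 <-> u \in M /\ vanishing A2 u.
Proof. by split=> [/Mx1P|h]; [|apply/Mx1P]. Qed.
Let M3E u : u \in M3 <-> u \in M /\ vanishing A3 u.
Proof. by split=> [/Mx2P|h]; [|apply/Mx2P]. Qed.
Let M23E u : u \in M23 <-> u \in M /\ vanishing A23 u.
Proof.
split=> [/andP[/M2E[uM u2] /M3E[_ u3]]|[uM u23]].
  by split=> // b x y z /orP[/u2|/u3]; apply.
apply/andP; split.
  by apply/M2E; split=> // b x y z lt; apply: u23; apply/orP; left.
by apply/M3E; split=> // b x y z lt; apply: u23; apply/orP; right.
Qed.
Let d2 : dbr c2 t2 = 0. Proof. exact: dbr2_t2 odd_t2 c2E. Qed.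
Let d3 : dbr c3 t3 = 0. Proof. exact: dbr2_t2 odd_t3 c3E. Qed.

Let st0 : stable_zeros k2 k3 A0. Proof. by split. Qed.
Let st1 : stable_zeros k2 k3 A1. Proof. by split=> *; rewrite ?/A1 //; right. Qed.
Let st2 : stable_zeros k2 k3 A2.
Proof.
split=> [y z /ltnW //|//|y z|y z]; last by right.
by rewrite /A2 leq_eqVlt => /predU1P[->|lt]; [left | right].
Qed.
Let st3 : stable_zeros k2 k3 A3.
Proof.
split=> [//|y z /ltnW //|y z|y z]; first by right.
by rewrite /A3 leq_eqVlt => /predU1P[->|lt]; [left | right].
Qed.
Let st23 : stable_zeros k2 k3 A23.
Proof.
have [a2 b2 u2 v2] := st2; have [a3 b3 u3 v3] := st3.
split=> y z /orP[h|h].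
- by apply/orP; left; exact: (a2 y z).
- by apply/orP; right.
- by apply/orP; left.
- by apply/orP; right; exact: (b3 y z).
- by have [E|E] := u2 y z h; [left | right; apply/orP; left].
- by right; apply/orP; right.
- by right; apply/orP; left.
by have [E|E] := v3 y z h; [left | right; apply/orP; right].
Qed.

Let j1 := inord 1 : 'I_3.
Let j2 := inord 2 : 'I_3.
Let bY : biop k j1 = biY k := biop_1 k.
Let bZ : biop k j2 = biZ k := biop_2 k.
Let j3 (j : 'I_3) : [\/ j = ord0, j = j1 | j = j2].
Proof.
by apply: (@ord3P (fun j => [\/ j = ord0, j = j1 | j = j2]));
  [constructor 1 | constructor 2 | constructor 3].
Qed.

Let N1 : (-1 : C) * 1 = -1. Proof. exact: mulr1. Qed.
Let N2 : (1 : C) * -1 = -1. Proof. exact: mul1r. Qed.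

Lemma M23_iso : iso_mx (biop k) M23 (dsum2 W1).
Proof.
have [E0 E1 E2] := twist_W1 (n - t2 - t3) (c1 + c3 + N) (- c1 - c2 - N) (- N).
have kap := W1_kappa c1 even_n odd_t2 odd_t3 c2E c3E le_t_n.
have t2_gt0 : (0 < t2)%N by rewrite odd_gt0.
have t3_gt0 : (0 < t3)%N by rewrite odd_gt0.
have le : (t2 + (n - t2 - t3) <= n)%N by move: le_t_n; lia.
have ev := W1_even even_n odd_t2 odd_t3 le_t_n.
have EL : W1 j2 = -1 *: OX (n - t2 - t3) (c1 + c3 + N) by rewrite scaleN1r.
have ER : W1 j1 = 1 *: OY (n - t2 - t3) (c1 + c3 + N) (- c1 - c2 - N) (- N).
  by rewrite scale1r.
apply: (Z_window_iso even_n k1_neq0 M23E st23 st1 ev N1 E0 kap bY bZ j3 le EL ER).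
- by move=> i le_i; rewrite mulN1r; exact: (W1_theta c1 even_n odd_t2 odd_t3 c2E c3E le_t_n i).
- by move=> i le_i; rewrite mul1r; exact: (W1_thetas c1 even_n odd_t2 odd_t3 c2E c3E le_t_n le_i).
- by move=> i lt_i; exact: (W1_phi c1 even_n odd_t2 odd_t3 c2E c3E le_t_n lt_i).
- move=> i lt_i; apply: (dbr2_neq0 c3E); first by lia.
  by apply/eqP; lia.
- by move=> o' E; apply/orP; left; lia.
- by move=> lt; right; apply/orP; right; lia.
- by move=> y z E /orP[] lt; lia.
- by move=> y z E; apply/esym; rewrite /A23 /A1; lia.
exact: (fun _ _ => erefl).
Qed.

Section W2Quotient.
Variables (AS AU : nat -> nat -> bool) (S U : pred (Cpt R)).
Hypothesis SE : forall u, u \in S <-> u \in M /\ vanishing AS u.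
Hypothesis UE : forall u, u \in U <-> u \in M /\ vanishing AU u.
Hypothesis stS : stable_zeros k2 k3 AS.
Hypothesis stU : stable_zeros k2 k3 AU.
Hypothesis AS_le : forall y z, AS y z -> A3 y z.
Hypothesis AUE : forall y z, AU y z = AS y z || A2 y z.

(** Both quotients of this type keep the window y < t_2. On y + z = n it is disjoint from [AS],
    because z < t_3 forces y > n - t_3 >= t_2. *)
Lemma W2_quot : {subset U <= S} -> quot_iso (biop k) S U (dsum2 W2).
Proof.
have [E0 E1 E2] := twist_W2 t2.-1 c1 (- K - n.+1%:R) (- c3).
have kap := W2_kappa c1 n odd_t2 c2E c3E.
have t2_gt0 : (0 < t2)%N by rewrite odd_gt0.
have le : (0 + t2.-1 <= n)%N by move: le_t_n; lia.
have ev := even_pred odd_t2.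
have EL : W2 j2 = 1 *: OX t2.-1 c1 by rewrite scale1r.
have ER : W2 j1 = -1 *: OY t2.-1 c1 (- K - n.+1%:R) (- c3) by rewrite scaleN1r.
apply: (Z_window_quot even_n k1_neq0 SE UE stS stU ev N2 E0 kap bY bZ j3 le EL ER).
- by move=> i le_i; rewrite mul1r add0n; exact: (W2_theta c1 odd_t2 c2E i).
- move=> i le_i; rewrite mulN1r add0n subn0.
  exact: (W2_thetas c1 even_n odd_t2 odd_t3 c2E c3E le_t_n le_i).
- move=> i lt_i; rewrite add0n subn0.
  exact: (W2_phi c1 even_n odd_t2 odd_t3 c2E c3E le_t_n lt_i).
- move=> i lt_i; rewrite subn0; apply: (dbr2_neq0 c3E); first by lia.
  by apply/eqP; lia.
- by [].
(* The window ends at t_2 - 1, where T_2 x_2^(t_2) = 0 cuts the line. *)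
- by move=> _; left; rewrite add0n prednK.
- by move=> y z E /AS_le; rewrite /A3 => lt; lia.
by move=> y z E; rewrite AUE; apply: (congr1 (orb _)); rewrite /A2; lia.
Qed.

End W2Quotient.

Section W3Quotient.
Variables (AS AU : nat -> nat -> bool) (S U : pred (Cpt R)).
Hypothesis SE : forall u, u \in S <-> u \in M /\ vanishing AS u.
Hypothesis UE : forall u, u \in U <-> u \in M /\ vanishing AU u.
Hypothesis stS : stable_zeros k2 k3 AS.
Hypothesis stU : stable_zeros k2 k3 AU.
Hypothesis AS_le : forall y z, AS y z -> A2 y z.
Hypothesis AUE : forall y z, AU y z = AS y z || A3 y z.

Let le_t_n' : (t3 + t2 <= n)%N. Proof. by rewrite addnC. Qed.

Lemma W3_quot : {subset U <= S} -> quot_iso (biop k) S U (dsum2 W3).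
Proof.
have KE : K = c1 + c3 + c2 by rewrite addrAC.
have [E0 E1 E2] := twist_W3 t3.-1 c1 (- K - n.+1%:R) (- c2).
have kap : 2 * c1 * (- K - n.+1%:R) - - c2 * t3.-1.+1%:R = - lamX c1 c2 c3 n.
  rewrite KE (W2_kappa c1 n odd_t3 c3E c2E) /lamX (addrAC c1) -(mulrA 2 c3) (mulrC c3).
  by rewrite (mulrA 2 c2).
have t3_gt0 : (0 < t3)%N by rewrite odd_gt0.
have le : (t3.-1 <= n)%N by move: le_t_n; lia.
have ev := even_pred odd_t3.
have EL : W3 j1 = 1 *: OX t3.-1 c1 by rewrite scale1r.
have ER : W3 j2 = -1 *: OY t3.-1 c1 (- K - n.+1%:R) (- c2) by rewrite scaleN1r.
apply: (Y_window_quot even_n k1_neq0 SE UE stS stU ev N2 E0 kap bY bZ j3 le EL ER).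
- by move=> i le_i; rewrite mul1r; exact: (W2_theta c1 odd_t3 c3E i).
- move=> i le_i; rewrite mulN1r KE.
  exact: (W2_thetas c1 even_n odd_t3 odd_t2 c3E c2E le_t_n' le_i).
- move=> i lt_i; rewrite KE.
  exact: (W2_phi c1 even_n odd_t3 odd_t2 c3E c2E le_t_n' lt_i).
- move=> i lt_i; apply: (dbr2_neq0 c2E); first by lia.
  by apply/eqP; lia.
- by move=> _; left; rewrite prednK.
- by move=> y z E /AS_le; rewrite /A2 => lt; lia.
by move=> y z E; rewrite AUE; apply: (congr1 (orb _)); rewrite /A3; lia.
Qed.

End W3Quotient.

Lemma M3_quot : quot_iso (biop k) M3 M23 (dsum2 W2).
Proof.
apply: (W2_quot M3E M23E st3 st23) => [//|y z|u /andP[]//].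
by rewrite /A23 orbC.
Qed.

Lemma M_quot2 : quot_iso (biop k) M M2 (dsum2 W2).
Proof. by apply: (W2_quot ME M2E st0 st2) => // u /M2E[]. Qed.

Lemma M2_quot : quot_iso (biop k) M2 M23 (dsum2 W3).
Proof. by apply: (W3_quot M2E M23E st2 st23) => [//|//|u /andP[]//]. Qed.

Lemma M_quot3 : quot_iso (biop k) M M3 (dsum2 W3).
Proof. by apply: (W3_quot ME M3E st0 st3) => // u /M3E[]. Qed.

Hypothesis c1_ge0 : 0 <= c1.

Let le_t_n' : (t3 + t2 <= n)%N. Proof. by rewrite addnC. Qed.

Lemma W1_irr_iso : mx_irr W1 /\ mx_iso W1 (Omod (n - t2 - t3) N (- c1 - c2 - N) (- c1 - c3 - N)).
Proof.
have ev := W1_even even_n odd_t2 odd_t3 le_t_n.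
have sep := W1_sep even_n odd_t2 odd_t3 c2E le_t_n c1_ge0.
have phi := W1_phi_neq0 even_n odd_t2 odd_t3 c2E c3E le_t_n c1_ge0.
have phi' := W1_phi'_neq0 even_n odd_t2 odd_t3 c2E c3E le_t_n c1_ge0.
split; first exact: (@twist_W1_irr _ _ ev _ _ _ sep phi phi').
by have := twist_W1_iso ev sep phi phi'; rewrite opprK opprD opprD.
Qed.

Lemma W2_irr_iso : mx_irr W2 /\ mx_iso W2 (Omod t2.-1 c3 (K + n.+1%:R) c1).
Proof.
have ev := even_pred odd_t2.
have sep := W2_sep even_n odd_t2 odd_t3 c2E c3E le_t_n c1_ge0.
have phi := W2_phi_neq0 even_n odd_t2 odd_t3 c2E c3E le_t_n c1_ge0.
have phi' := W2_phi'_neq0 even_n odd_t2 odd_t3 c2E c3E le_t_n c1_ge0.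
split; first exact: (@twist_p1m1_irr _ _ ev _ _ _ sep phi phi' _).
have := twist_W2_iso ev sep phi phi'.
by rewrite (opprK c3) (opprB (- K)) (opprK K) (addrC _ K).
Qed.

Lemma W3_irr_iso : mx_irr W3 /\ mx_iso W3 (Omod t3.-1 c2 c1 (K + n.+1%:R)).
Proof.
have ev := even_pred odd_t3.
have KE : K = c1 + c3 + c2 by rewrite addrAC.
have sep := W2_sep even_n odd_t3 odd_t2 c3E c2E le_t_n' c1_ge0.
have phi := W2_phi_neq0 even_n odd_t3 odd_t2 c3E c2E le_t_n' c1_ge0.
have phi' := W2_phi'_neq0 even_n odd_t3 odd_t2 c3E c2E le_t_n' c1_ge0.
rewrite KE; split; first exact: (@twist_p1m1_irr _ _ ev _ _ _ sep phi phi' _).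
have := twist_W3_iso ev sep phi phi'.
by rewrite (opprK c2) (opprB (- (c1 + c3 + c2))) (opprK (c1 + c3 + c2)) (addrC _ (c1 + c3 + c2)).
Qed.

End Assembly.

Theorem theorem8p14 (R : realType) (k1 k2 k3 : R) (n t2 t3 : nat) :
  ~~ odd n ->
  tparam k2 t2 -> tparam k3 t3 -> (t2 + t3 <= n)%N ->
  (forall t1 : nat, tparam k1 t1 -> (n < t1)%N) ->
  let k := kvec k1 k2 k3 in
  let K : R[i] := rC (k1 + k2 + k3) in
  let N : R[i] := n.+1%:R / 2 in
  let M := Mn k n in
  let M2 := Mx k 1 t2 n in
  let M3 := Mx k 2 t3 n in
  let M23 := [predI M2 & M3] in
  let W1 := twist aut_m1p1 perm13
              (Omod (n - t2 - t3) (rC k1 + rC k3 + N) (- rC k1 - rC k2 - N) (- N)) in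
  let W2 := twist aut_p1m1 perm13
              (Omod t2.-1 (rC k1) (- K - n.+1%:R) (- rC k3)) in
  let W3 := twist aut_p1m1 perm132
              (Omod t3.-1 (rC k1) (- K - n.+1%:R) (- rC k2)) in
  [/\ iso_mx (biop k) M23 (dsum2 W1),
      quot_iso (biop k) M3 M23 (dsum2 W2) /\ quot_iso (biop k) M M2 (dsum2 W2),
      quot_iso (biop k) M2 M23 (dsum2 W3) /\ quot_iso (biop k) M M3 (dsum2 W3) &
      0 <= k1 ->
      [/\ mx_irr W1, mx_irr W2 & mx_irr W3] /\
      [/\ mx_iso W1 (Omod (n - t2 - t3) N (- rC k1 - rC k2 - N) (- rC k1 - rC k3 - N)),
          mx_iso W2 (Omod t2.-1 (rC k3) (K + n.+1%:R) (rC k1)) &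
          mx_iso W3 (Omod t3.-1 (rC k2) (rC k1) (K + n.+1%:R))]].
Proof.
move=> even_n [odd_t2 k2E] [odd_t3 k3E] le_t_n t1 k K N.
have KE : K = rC k1 + rC k2 + rC k3 by rewrite /K /rC !rmorphD.
rewrite KE {K KE}.
have c2E := rC_tparam k2E; have c3E := rC_tparam k3E.
have k1_neq0 := rC_dbr_neq0 t1.
split.
- exact: (M23_iso even_n odd_t2 odd_t3 c2E c3E le_t_n k1_neq0).
- split; first exact: (M3_quot even_n odd_t2 odd_t3 c2E c3E le_t_n k1_neq0).
  exact: (M_quot2 even_n odd_t2 odd_t3 c2E c3E le_t_n k1_neq0).
- split; first exact: (M2_quot even_n odd_t2 odd_t3 c2E c3E le_t_n k1_neq0).
  exact: (M_quot3 even_n odd_t2 odd_t3 c2E c3E le_t_n k1_neq0).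
move=> k1_ge0; have c1_ge0 : 0 <= rC k1 by rewrite /rC ler0c.
have [I1 J1] := W1_irr_iso even_n odd_t2 odd_t3 c2E c3E le_t_n c1_ge0.
have [I2 J2] := W2_irr_iso even_n odd_t2 odd_t3 c2E c3E le_t_n c1_ge0.
have [I3 J3] := W3_irr_iso even_n odd_t2 odd_t3 c2E c3E le_t_n c1_ge0.
by [].
Qed.
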